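(* Let $G$ be a finite graph (parallel edges allowed, no loops) and let $d$ and $k$ be positive integers. Define the fractional arboricity $\gamma(G) = \max_{H \subseteq G,\, v(H) \geq 2} \frac{e(H)}{v(H)-1}$, where $e(H)=|E(H)|$ and $v(H)=|V(H)|$. If $\gamma(G) \leq k + \frac{d}{d+k+1}$, then there is a partition of $E(G)$ into $k+1$ forests such that in one of these forests every connected component has at most \[ d + \left\lceil k\left(\left\lceil \tfrac{d}{k+1}\right\rceil - 1\right)\left(\frac{d}{k+1} - \frac{1}{2}\left\lceil \tfrac{d}{k+1}\right\rceil\right)\right\rceil \] edges.
   Context: Graphs may have parallel edges but no loops. The maximum in the definition of $\gamma(G)$ ranges over all subgraphs $H$ of $G$ with at least two vertices. *)

(* Defs.v *)
From HB Require Import structures.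
From mathcomp Require Import all_boot all_order all_algebra.
Set Implicit Arguments. Unset Strict Implicit. Unset Printing Implicit Defensive.
Import Order.TTheory GRing.Theory Num.Theory.
Local Open Scope ring_scope.

(* A finite multigraph (parallel edges allowed) is given by a finite vertex
   type V, a finite edge type E and an endpoint map ends : E -> V * V;
   "no loops" is the hypothesis  forall e, (ends e).1 != (ends e).2. *)

Definition joins (V E : finType) (ends : E -> V * V) (e : E) (x y : V) : bool :=
  ((ends e).1 == x) && ((ends e).2 == y) || ((ends e).1 == y) && ((ends e).2 == x).

(* Fractional arboricity: max over subgraphs H = (S, F) with |S| >= 2
   (F a set of edges with both ends in S) of e(H)/(v(H)-1).
   (Default value 0 when there is no such subgraph.) *)
Definition frac_arb (V E : finType) (ends : E -> V * V) : rat :=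
  \big[Num.max/0]_(S : {set V} | (2 <= #|S|)%N)
    \big[Num.max/0]_(F : {set E} |
        [forall e in F, ((ends e).1 \in S) && ((ends e).2 \in S)])
      ((#|F|)%:R / (#|S|.-1)%:R).

(* A cycle in the edge set F: m >= 2 distinct edges es_0..es_{m-1} of F and
   m distinct vertices vs_0..vs_{m-1}, es_i joining vs_i and vs_{i+1 mod m}.
   (m = 2 covers two parallel edges.) *)
Definition has_cycle (V E : finType) (ends : E -> V * V) (F : {set E}) : Prop :=
  exists (m : nat) (es : 'I_m -> E) (vs : 'I_m -> V),
    [/\ (2 <= m)%N, injective es, injective vs,
        forall i, es i \in F &
        forall i, joins ends (es i) (vs i) (vs (ordS i))].

Definition is_forest (V E : finType) (ends : E -> V * V) (F : {set E}) : Prop :=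
  ~ has_cycle ends F.

Definition adjF (V E : finType) (ends : E -> V * V) (F : {set E}) : rel V :=
  fun x y => [exists e in F, joins ends e x y].

Definition comp_edges (V E : finType) (ends : E -> V * V) (F : {set E}) (v : V)
  : {set E} :=
  [set e in F | connect (adjF ends F) v (ends e).1].

(* Main.v *)
Require Import Defs.
From HB Require Import structures.
From mathcomp Require Import all_boot all_order all_algebra.
From mathcomp Require Import zify ring.
From Stdlib Require Import Classical_Prop.
Import Order.TTheory GRing.Theory Num.Theory.
Set Implicit Arguments. Unset Strict Implicit. Unset Printing Implicit Defensive.
Local Open Scope nat_scope.

(** Colour the edges with [k] blue forests and one red forest, minimising first
    the number of red edges and then the total excess over [D] edges of the red
    components, where [(k+1) D >= d + k * \sum_(j <= s) (d - (k+1) j)] and [s] is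
    the largest integer below [d / (k+1)].  If some red component has more than
    [D] edges, root the blue forests at a centroid [r] of it and explore the graph
    from it along red components and along blue edges directed towards [r]; take
    an exploration whose sequence of component sizes is lexicographically least.

    An augmenting-path argument shows that every blue forest spans the explored
    set, so the density hypothesis forces the average red component in it to have
    fewer than [d / (k+1)] edges.  Call a component with at most [s] edges small.
    Exchanging the blue edges by which one forest leaves a component [K] for red
    edges that separate their tails inside [K] (plus one augmentation) would
    improve the colouring, unless through each blue forest [K] has at most [j+1]
    children with at most [j <= s] edges, and [K] has with any of its children at
    least [D] edges together.  The centroid [r] prevents small children of the
    first component.  Hence the surplus of each component outweighs the deficits
    of its small children, a contradiction.  The same augmenting argument with
    [k+1] forests yields the initial colouring (Nash-Williams). *)

Ltac nlia :=
  repeat match goal with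
  | H : is_true (leq _ _) |- _ => revert H
  | H : is_true (andb (leq _ _) (leq _ _)) |- _ => revert H
  | H : is_true (negb (leq _ _)) |- _ => revert H
  | H : @eq nat _ _ |- _ => revert H
  end; clear; intros; lia.

(** * Connectivity, bridges and rooted trees in edge sets *)

Section Connectivity.
Variables (V E : finType) (ends : E -> V * V).
Local Notation jn := (joins ends).
Implicit Types (F H : {set E}) (e f g : E) (x y u v r : V).

Definition conn F : rel V := connect (adjF ends F).

Definition component F v : {set V} := [set u | conn F v u].

(** Every edge is a bridge. This local form suits exchanges of single edges; [acyc_forest] turns it
    into the absence of cycles. *)
Definition acyc F : Prop :=
  forall e x y, e \in F -> jn e x y -> ~~ conn (F :\ e) x y.

Lemma joinsC e x y : jn e x y = jn e y x.
Proof. by rewrite /joins orbC. Qed.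

Lemma joins_ends e : jn e (ends e).1 (ends e).2.
Proof. by rewrite /joins !eqxx. Qed.

Lemma joins_inj e x y u v :
  jn e x y -> jn e u v -> (x = u /\ y = v) \/ (x = v /\ y = u).
Proof.
rewrite /joins => /orP[] /andP[/eqP <- /eqP <-] /orP[] /andP[/eqP <- /eqP <-];
  by [left | right].
Qed.

Lemma adjF_sym F : symmetric (adjF ends F).
Proof.
by move=> x y; apply/existsP/existsP=> -[e /andP[eF ej]]; exists e;
  rewrite eF /= joinsC.
Qed.

Lemma conn_refl F x : conn F x x. Proof. exact: connect0. Qed.
Hint Resolve conn_refl : core.

Lemma conn_sym F x y : conn F x y = conn F y x.
Proof. exact/sym_connect_sym/adjF_sym. Qed.

Lemma conn_trans F y x z : conn F x y -> conn F y z -> conn F x z.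
Proof. exact: connect_trans. Qed.

Lemma conn_join F e x y : e \in F -> jn e x y -> conn F x y.
Proof. by move=> eF ej; apply/connect1/existsP; exists e; rewrite eF. Qed.

Lemma conn_closed (Y : V -> bool) F x y :
    (forall e u v, e \in F -> jn e u v -> Y u -> Y v) ->
  conn F x y -> Y x -> Y y.
Proof.
move=> Ycl /connectP[s sP ->] {y}; elim: s x sP => //= z s IHs x.
case/andP=> /existsP[e /andP[eF ej]] sP Yx.
exact: IHs sP (Ycl _ _ _ eF ej Yx).
Qed.

Lemma conn_mono F H x y : F \subset H -> conn F x y -> conn H x y.
Proof.
move=> /subsetP sFH xy; apply: (conn_closed (Y := conn H x) _ xy) => //.
by move=> e u v /sFH eH ej xu; apply: conn_trans xu (conn_join eH ej).
Qed.

Lemma conn_subD F (X : {set E}) x y : conn (F :\: X) x y -> conn F x y.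
Proof. exact/conn_mono/subsetDl. Qed.

Lemma conn_local F H x y :
    (forall e u v, e \in F -> jn e u v -> conn F x u -> e \in H) ->
  conn F x y -> conn H x y.
Proof.
move=> FH xy.
suff: conn F x y && conn H x y by case/andP.
apply: (conn_closed (Y := fun v => conn F x v && conn H x v) _ xy); last first.
  by rewrite !conn_refl.
move=> e u v eF ej /andP[xu xu'].
by rewrite (conn_trans xu (conn_join eF ej)) (conn_trans xu') ?(conn_join _ ej) ?(FH e u v).
Qed.

Lemma conn_add F e p q x y : jn e p q -> conn (e |: F) x y ->
  [\/ conn F x y, conn F x p /\ conn F q y | conn F x q /\ conn F p y].
Proof.
move=> ej xy; pose Y v := [|| conn F x v, conn F x p && conn F q v
                            | conn F x q && conn F p v].
suff: Y y.
  by case/or3P=> [|/andP[]|/andP[]]; [constructor 1|constructor 2|constructor 3].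
apply: (conn_closed _ xy); last by rewrite /Y conn_refl.
move=> e' u v; rewrite in_setU1 => /predU1P[-> | e'F] ej'; last first.
  have uv := conn_join e'F ej'.
  by case/or3P=> [xu|/andP[xp qu]|/andP[xq pu]]; rewrite /Y;
    rewrite ?(conn_trans xu uv) ?xp ?xq ?(conn_trans qu uv) ?(conn_trans pu uv) ?orbT.
rewrite /Y; case: (joins_inj ej ej') => [[<- <-]|[<- <-]];
  by case/or3P=> [->|/andP[-> _]|/andP[-> _]]; rewrite ?conn_refl ?orbT.
Qed.

Lemma conn_del F e p q x y : e \in F -> jn e p q -> conn F x y ->
  [\/ conn (F :\ e) x y, conn (F :\ e) x p /\ conn (F :\ e) q y
    | conn (F :\ e) x q /\ conn (F :\ e) p y].
Proof. by move=> eF ej; rewrite -{1}(setD1K eF); apply: conn_add. Qed.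

(** On a simple path from [x] to [y], the first edge that leaves [B] occurs only once, so the
    segments before and after it both avoid that edge. *)
Lemma conn_exit H (B : V -> bool) x y : conn H x y -> B x -> ~~ B y ->
  exists g p q, [/\ g \in H /\ jn g p q, B p, ~~ B q,
    conn (H :\ g) x p & conn (H :\ g) q y].
Proof.
move=> /connectP[s0 s0P ->] Bx By {y}.
case/shortenP: s0P By => s sP sU _ By {s0}.
suff [g [p [q [[gH gj] Bp Bq [ps qs] [xp qy]]]]] : exists g p q,
    [/\ g \in H /\ jn g p q, B p, ~~ B q, p \in x :: s /\ q \in x :: s
      & conn (H :\ g) x p /\ conn (H :\ g) q (last x s)].
  by exists g, p, q.
elim: s x Bx sP sU By => [|z s IHs] x Bx /=; first by rewrite Bx.
case/andP=> /existsP[e /andP[eH ej]] sP /andP[xs sU] By.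
have avoid g w : jn g x w -> conn (H :\ g) z (last z s).
  move=> gj; apply/connectP; exists s => //.
  elim: s z {ej IHs sU By} sP xs => //= z' s IHs z /andP[/existsP[e' /andP[e'H ej']] sP].
  rewrite !inE !negb_or => /and3P[xz xz' xs]; rewrite IHs ?andbT // ?inE ?negb_or ?xz' //.
  apply/existsP; exists e'; rewrite !inE e'H ej' andbT /= andbT.
  apply/negP=> /eqP Eg; rewrite {}Eg in ej'.
  by case: (joins_inj gj ej') xz xz' => [[-> _]|[-> _]]; rewrite eqxx.
case: (boolP (B z)) => Bz; last first.
  exists e, x, z; split=> //; first by rewrite !inE !eqxx orbT.
  by split=> //; apply: avoid ej.
have [g [p [q [[gH gj] Bp Bq [ps qs] [zp qy]]]]] := IHs z Bz sP sU By.
exists g, p, q; split=> //; first by rewrite ![_ \in x :: _]in_cons ps qs !orbT.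
split=> //; apply: conn_trans zp; apply: (@conn_join _ e) => //.
rewrite !inE eH andbT; apply/negP=> /eqP Eg; rewrite -{}Eg in gj.
by case: (joins_inj gj ej) => [[Ep _]|[_ Eq]]; move: xs;
  rewrite -?Ep -?Eq ?ps ?qs.
Qed.

Lemma acyc_sub F H : F \subset H -> acyc H -> acyc F.
Proof.
move=> sFH aH e x y eF ej; apply: contra (aH e x y (subsetP sFH e eF) ej).
exact/conn_mono/setSD.
Qed.

Lemma acyc_add F e p q : acyc F -> jn e p q -> ~~ conn F p q -> acyc (e |: F).
Proof.
move=> aF ej npq e' x y e'eF ej'.
have [Ee|ne] := eqVneq e' e.
  rewrite {e' e'eF}Ee in ej' *; apply: contra npq => xy.
  have {}xy : conn F x y.
    by apply: conn_mono xy; apply/subsetP=> z; rewrite !inE; case: eqP.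
  by case: (joins_inj ej ej') => [[-> ->]|[-> ->]] //; rewrite conn_sym.
have e'F : e' \in F by move: e'eF; rewrite !inE (negPf ne).
have xy := conn_join e'F ej'.
apply/negP=> /(conn_mono (H := e |: (F :\ e'))) cxy.
have /(conn_add ej) : conn (e |: (F :\ e')) x y.
  by apply: cxy; apply/subsetP=> z; rewrite !inE; do 2!case: eqP.
case=> [|[/conn_subD xp /conn_subD qy]|[/conn_subD xq /conn_subD py]].
- exact/negP/(aF e').
- move/negP: npq; apply; rewrite conn_sym.
  by apply: conn_trans qy _; rewrite conn_sym in xy; apply: conn_trans xy _.
- move/negP: npq; apply; apply: conn_trans py _.
  by rewrite conn_sym in xy; apply: conn_trans xy _.
Qed.

Lemma acyc_add_cut F e p q (Y : V -> bool) :
    acyc F -> jn e p q -> Y p -> ~~ Y q ->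
    (forall e' u v, e' \in F -> jn e' u v -> Y u -> Y v) ->
  acyc (e |: F).
Proof.
move=> aF ej Yp Yq cl; apply: acyc_add ej _ => //.
by apply: contra Yq => /(conn_closed cl); apply.
Qed.

(** Each new edge [e] has a cut [Y e] of its own, crossed by no other edge of the union, so the new
    edges can be inserted one by one. *)
Lemma acyc_add_cuts F (X : {set E}) (Y : E -> V -> bool) :
    acyc F ->
    (forall e, e \in X -> exists p q, [/\ jn e p q, Y e p & ~~ Y e q]) ->
    (forall e e' u v, e \in X -> e' \in F :|: X -> e' != e ->
       jn e' u v -> Y e u -> Y e v) ->
  acyc (F :|: X).
Proof.
move=> aF; have [n] := ubnP #|X|; elim: n X => // n IHX X ltXn cr cl.
have [->|[e eX]] := set_0Vmem X; first by rewrite setU0.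
have [p [q [ej Yp Yq]]] := cr e eX.
have -> : F :|: X = e |: (F :|: X :\ e).
  by apply/setP=> z; rewrite !inE; case: eqP => [->|]; rewrite ?eX ?orbT.
have [eF|eF] := boolP (e \in F).
  rewrite (setUidPr _); last by rewrite sub1set inE eF.
  apply: IHX => [|e' /setD1P[_ /cr] //|e1 e2 u v /setD1P[_ e1X] e2U].
    by rewrite (cardsD1 e) eX in ltXn.
  apply: cl => //; move: e2U; rewrite !inE => /orP[->//|/andP[_ ->]]; exact: orbT.
apply: (acyc_add_cut _ ej Yp Yq).
  apply: IHX => [|e' /setD1P[_ /cr] //|e1 e2 u v /setD1P[_ e1X] e2U].
    by rewrite (cardsD1 e) eX in ltXn.
  apply: cl => //; move: e2U; rewrite !inE => /orP[->//|/andP[_ ->]]; exact: orbT.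
move=> e' u v e'U ej'; apply: cl ej' => //.
  by move: e'U; rewrite !inE => /orP[->//|/andP[_ ->]]; exact: orbT.
by apply: contraNneq eF => Ee; move: e'U; rewrite !inE Ee eqxx /= orbF.
Qed.

(** The connection from [u] to [v] in [B] runs through [e]. A detour from [u] to [v] in [A :\ e],
    together with the two remaining segments, would join the ends of [e] without [e]. *)
Lemma acyc_bridge (A B : {set E}) e u v : acyc A -> B \subset A -> e \in B ->
  conn B u v -> ~~ conn (B :\ e) u v -> ~~ conn (A :\ e) u v.
Proof.
move=> aA sBA eB uv nuv; apply/negP=> uvA.
have eA := subsetP sBA e eB; have ej := joins_ends e.
have sub : B :\ e \subset A :\ e by apply: setSD.
move/negP: (aA e _ _ eA ej); apply.
case: (conn_del eB ej uv) => [|[up qv]|[uq pv]]; first by rewrite (negPf nuv).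
  apply: (@conn_trans _ u); first by rewrite conn_sym (conn_mono sub).
  by apply: conn_trans uvA _; rewrite conn_sym (conn_mono sub).
apply: conn_trans (conn_mono sub pv) _; rewrite conn_sym in uvA.
by apply: conn_trans uvA _; rewrite (conn_mono sub).
Qed.

Lemma out_edge_exists F v r : acyc F -> conn F v r -> v != r ->
  exists e y, [/\ e \in F, jn e v y & ~~ conn (F :\ e) v r].
Proof.
move=> aF vr nvr.
have [|g [p [q [[gF gj] /eqP Ep _ _ qr]]]] := conn_exit (B := pred1 v) vr (eqxx v).
  by rewrite /= eq_sym.
rewrite {p}Ep in gj; exists g, q; split=> //.
apply: contra (aF g v q gF gj) => cvr.
by apply: conn_trans cvr _; rewrite conn_sym.
Qed.

Lemma out_edge_head F e v y r : e \in F -> jn e v y -> conn F v r ->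
  ~~ conn (F :\ e) v r -> conn (F :\ e) y r.
Proof.
move=> eF ej vr nvr; case: (conn_del eF ej vr) => [|[] //|[]] //.
  by rewrite (negPf nvr).
by move=> _; rewrite (negPf nvr).
Qed.

(** With the tree oriented towards [r], each tail becomes the root of the piece below its deleted
    out-edge. For [v = v'] this says that an out-edge is unique. *)
Lemma out_edges_separate F e e' v y v' y' r : acyc F -> conn F v r -> conn F v' r ->
    e \in F -> e' \in F -> jn e v y -> jn e' v' y' ->
    ~~ conn (F :\ e) v r -> ~~ conn (F :\ e') v' r -> e != e' ->
  ~~ conn (F :\ e :\ e') v v'.
Proof.
move=> aF vr v'r eF e'F ej ej' nv nv' ne; apply/negP=> vv'.
have e'Fe : e' \in F :\ e by rewrite !inE eq_sym ne.
have eFe' : e \in F :\ e' by rewrite !inE ne.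
have y'r := out_edge_head e'F ej' v'r nv'.
have Ed : F :\ e' :\ e = F :\ e :\ e'.
  by apply/setP=> z; rewrite !inE andbCA.
move: (conn_del eFe' ej y'r); rewrite Ed.
case=> [y'r2|[y'v _]|[_ /conn_subD]]; last by rewrite (negPf nv).
- move/negP: nv; apply; apply: conn_trans (conn_subD vv') _.
  exact: conn_trans (conn_join e'Fe ej') (conn_subD y'r2).
- move/negP: (aF e' v' y' e'F ej'); apply; rewrite conn_sym -(setD1K eFe').
  by apply: conn_mono (conn_trans y'v vv'); rewrite Ed subsetUr.
Qed.

Lemma joins_conn_comp F e x y v : e \in F -> jn e x y -> conn F v x = conn F v y.
Proof.
move=> eF ej; have xy := conn_join eF ej.
by apply/idP/idP=> [vx|vy]; [exact: conn_trans xy|rewrite conn_sym in xy; exact: conn_trans xy].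
Qed.

Lemma conn_agree F H x v :
    (forall e u y, jn e u y -> conn F x u -> (e \in F) = (e \in H)) ->
  conn H x v = conn F x v.
Proof.
move=> agree; apply/idP/idP=> h; last first.
  by apply: conn_local h => e u y eF ej xu; rewrite -(agree e u y).
apply: (conn_closed (Y := conn F x) _ h) => // e u y eH ej xu.
by rewrite -(joins_conn_comp _ (e := e) (x := u)) // (agree e u y).
Qed.

Lemma conn_equivalence F : equivalence_rel (conn F).
Proof.
move=> x y z; split=> [|xy]; first exact: conn_refl.
apply/idP/idP; last exact: conn_trans.
by apply: conn_trans; rewrite conn_sym.
Qed.

End Connectivity.
#[export] Hint Resolve conn_refl : core.

(** * Colourings, explorations and augmenting paths *)

Section Exploration.
Variables (V E : finType) (ends : E -> V * V) (K : nat).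
Local Notation jn := (joins ends).
Local Notation conn := (conn ends).
Local Notation component := (component ends).
Local Notation acyc := (acyc ends).
Implicit Types (F : {set E}) (col : E -> option 'I_K) (c : 'I_K) (e f : E) (u v r y : V)
  (w : nat -> V) (Y : V -> bool).

Definition cls col (o : option 'I_K) : {set E} := [set e | col e == o].
Definition blue col c := cls col (Some c).
Definition red col := cls col None.
Definition blue_acyc col := forall c, acyc (blue col c).
Definition upd col e (o : option 'I_K) : E -> option 'I_K :=
  fun e' => if e' == e then o else col e'.

Definition closed_under (F : {set E}) Y :=
  forall e u v, e \in F -> jn e u v -> Y u -> Y v.

(* Blue trees are oriented towards [r]: [e] leads from [u] to [y]. *)
Definition arc_via col r c e u y :=
  [&& e \in blue col c, jn e u y & ~~ conn (blue col c :\ e) u r].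

Definition arrow col r u y := exists c e, arc_via col r c e u y.

Definition reached col w j :=
  exists m u, [/\ m < j, conn (red col) (w m) u & arrow col (w 0) u (w j)].

(* The red components of [w 0], ..., [w n.-1] are distinct, and each but the
   first is entered at [w j] by an arrow from an earlier one. *)
Definition legal col w n := forall j, 0 < j < n ->
  reached col w j /\ (forall m, m < j -> ~~ conn (red col) (w m) (w j)).

Lemma cls_upd_same col e o : cls (upd col e o) o = e |: cls col o.
Proof. by apply/setP=> e'; rewrite !inE /upd; case: (e' =P e); rewrite ?eqxx. Qed.

Lemma cls_upd_neq col e o o' : o' != o -> cls (upd col e o) o' = cls col o' :\ e.
Proof.
move=> ne; apply/setP=> e'; rewrite !inE /upd; case: (e' =P e) => //= _.
by rewrite eq_sym; apply/negbTE.
Qed.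

Definition recolor col c (X G : {set E}) : E -> option 'I_K :=
  fun e => if e \in X then None else if e \in G then Some c else col e.

Section Recolor.
Variables (col : E -> option 'I_K) (c : 'I_K) (X G : {set E}).
Hypotheses (sX : X \subset blue col c) (sG : G \subset red col).

Lemma red_recolor : red (recolor col c X G) = (red col :\: G) :|: X.
Proof.
apply/setP=> e; rewrite !inE /recolor; case: (e \in X); rewrite ?orbT //.
by case: (e \in G); rewrite ?orbF.
Qed.

Lemma blue_recolor : blue (recolor col c X G) c = (blue col c :\: X) :|: G.
Proof.
apply/setP=> e; rewrite !inE /recolor; have [eX|_] := boolP (e \in X).
  by apply/esym/negP=> /(subsetP sG); move/(subsetP sX): eX; rewrite !inE => /eqP->.
by case: (e \in G); rewrite ?orbT ?orbF ?eqxx.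
Qed.

Lemma blue_recolor_neq c' : c' != c -> blue (recolor col c X G) c' = blue col c'.
Proof.
move=> nc; apply/setP=> e; rewrite !inE /recolor.
case: ifP => [/(subsetP sX)|_].
  by rewrite inE => /eqP->; apply/esym/eqP=> -[Ec]; rewrite Ec eqxx in nc.
case: ifP => [/(subsetP sG)|//]; rewrite inE => /eqP->.
by apply/eqP=> -[Ec]; rewrite Ec eqxx in nc.
Qed.

Lemma card_recolor : #|red (recolor col c X G)| + #|G| = #|red col| + #|X|.
Proof.
have dX : (red col :\: G) :&: X = set0.
  apply/setP=> e; rewrite !inE; case: (e =P e) => // _.
  by apply/negP=> /andP[/andP[_ /eqP h] /(subsetP sX)]; rewrite inE h.
have := cardsUI (red col :\: G) X; rewrite dX cards0 addn0 red_recolor => ->.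
by rewrite addnAC -(cardsID G (red col)) (setIidPr sG) [#|G| + _]addnC.
Qed.

End Recolor.

Lemma closed_conn F Y u v : closed_under F Y -> conn F u v -> Y u = Y v.
Proof.
move=> cl uv; apply/idP/idP; first exact: conn_closed uv.
by rewrite conn_sym in uv; apply: conn_closed uv.
Qed.

Lemma closed_sub (F F' : {set E}) Y : F' \subset F -> closed_under F Y -> closed_under F' Y.
Proof. by move=> /subsetP sF cl e u v /sF; apply: cl. Qed.

Lemma comp_closed F u : closed_under F (conn F u).
Proof. by move=> e x y eF ej ux; rewrite -(joins_conn_comp _ eF ej). Qed.

(** [Y] is a union of components of the forest [c] that contains neither [u] nor [r]. The added edge
    [e0] only attaches [Y] to the rest, so it cannot help to join [u] to [r]. *)
Lemma arc_upd col r c' e u y c e0 a b Y :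
    arc_via col r c' e u y -> e != e0 -> closed_under (blue col c) Y ->
    jn e0 b a -> Y a -> ~~ Y b -> ~~ Y u -> ~~ Y r ->
  arc_via (upd col e0 (Some c)) r c' e u y.
Proof.
case/and3P=> ec ej nur ne cl ej0 Ya Yb Yu Yr.
rewrite /arc_via ej /=; apply/andP; split.
  by move: ec; rewrite /blue !inE /upd (negPf ne).
have [Ec|nc] := eqVneq c' c; last first.
  rewrite /blue cls_upd_neq; last by apply: contraNneq nc => -[->].
  by apply: contra nur; apply: conn_mono; apply: setSD; apply: subsetDl.
rewrite {c'}Ec in ec nur *; rewrite /blue cls_upd_same.
have -> : (e0 |: cls col (Some c)) :\ e = e0 |: (cls col (Some c) :\ e).
  by apply/setP=> z; rewrite !inE; have [->|] := eqVneq z e0; rewrite ?(eq_sym e0) ?ne.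
have cl' : closed_under (blue col c :\ e) Y by apply: closed_sub cl; apply: subsetDl.
apply/negP=> /(conn_add ej0)[||[ua br]].
- exact/negP.
- by case=> _ /(closed_conn cl') Ear; rewrite -Ear Ya in Yr.
- by move/(closed_conn cl'): ua => Eua; rewrite Eua Ya in Yu.
Qed.

(** Augmenting path. Consider the first red component that meets [Y], say that of [w l]. If [w l] is
    outside [Y], some red edge of the component crosses the boundary of [Y] and can join the forest
    [c]. Otherwise the arrow entering at [w l] crosses this boundary and can move to [c]; its tail
    is then cut off from the root in its old forest, and the argument continues with an earlier
    component. Components before [w l] miss [Y], which keeps their entering arrows intact. *)
Lemma augment col w m c Y :
    blue_acyc col -> legal col w m.+1 ->
    closed_under (blue col c) Y -> ~~ Y (w 0) ->
    (exists y, conn (red col) (w m) y /\ Y y) ->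
  exists l f a b col', [/\ l <= m /\ (Y (w m) -> l < m),
    f \in red col /\ jn f b a, conn (red col :\ f) (w l) b,
    blue_acyc col' /\ red col' = red col :\ f
    & forall j, 0 < j <= l -> exists m u,
        [/\ m < j, conn (red col) (w m) u & arrow col' (w 0) u (w j)]].
Proof.
have [N] := ubnP m; elim: N => // N IHN in col m c Y *.
rewrite ltnS => leN aB leg cl Yr Ym.
pose P j := [exists y, conn (red col) (w j) y && Y y].
have exP : exists j, P j.
  by case: Ym => y [my Yy]; exists m; apply/existsP; exists y; rewrite my.
case: (ex_minnP exP) => l Pl minl.
have lm : l <= m.
  by apply: minl; case: Ym => y [my Yy]; apply/existsP; exists y; rewrite my.
have nY j u : j < l -> conn (red col) (w j) u -> ~~ Y u.
  move=> jl ju; apply/negP=> Yu.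
  by have /minl : P j; [apply/existsP; exists u; rewrite ju | rewrite leqNgt jl].
case/existsP: Pl => a0 /andP[la0 Ya0].
have [Yl|Yl] := boolP (Y (w l)); last first.
  have [||f [b [a [[fR fj] Yb Ya lb aa0]]]] :=
    conn_exit (B := fun v => ~~ Y v) la0; rewrite ?negbK //.
  rewrite negbK in Ya.
  exists l, f, a, b, (upd col f (Some c)); split=> //.
  - split=> //; rewrite leq_eqVlt in lm; case/predU1P: lm => // Elm.
    by rewrite -Elm (negPf Yl).
  - split; last by rewrite /red cls_upd_neq.
    move=> c'; have [->|nc] := eqVneq c' c; last first.
      rewrite /blue cls_upd_neq; last by apply: contraNneq nc => -[->].
      by apply: acyc_sub (aB c'); apply: subsetDl.
    rewrite /blue cls_upd_same; apply: acyc_add (aB c) fj _.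
    by apply/negP=> /(closed_conn cl) Eba; rewrite Eba Ya in Yb.
  move=> j /andP[j0 jl].
  case: (leg j) => [|[m' [u [m'j m'u [c' [e arce]]]]] _].
    by rewrite j0 ltnS (leq_trans jl).
  exists m', u; split=> //; exists c', e.
  apply: (arc_upd arce _ cl fj Ya Yb (nY m' u _ m'u) Yr); last exact: leq_trans jl.
  apply/negP=> /eqP Ee; case/and3P: arce => ec _ _; move: fR ec.
  by rewrite Ee /blue /red !inE => /eqP->.
have l0 : 0 < l by rewrite lt0n; apply: contraNneq Yr => <-.
case: (leg l) => [|[m' [u [m'l m'u [c' [e arce]]]]] sepl].
  by rewrite l0 ltnS lm.
have Yu := nY _ _ m'l m'u.
case/and3P: (arce) => ec ej nur.
(* In the forest [c] the arrow would be an edge across the boundary of the closed set [Y]. *)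
have nc : c' != c.
  apply: contraNneq Yu => Ec; rewrite Ec in ec; apply: cl ec _ Yl.
  by rewrite joinsC.
pose col1 := upd col e (Some c).
have R1 : red col1 = red col.
  rewrite /red cls_upd_neq //; apply/setDidPl; rewrite disjoint_sym disjoints1.
  by move: ec; rewrite /blue !inE => /eqP->.
have B1 : blue col1 c' = blue col c' :\ e.
  by rewrite /blue cls_upd_neq //; apply: contraNneq nc => -[->].
have aB1 : blue_acyc col1.
  move=> c1; have [->|nc1] := eqVneq c1 c; last first.
    rewrite /blue cls_upd_neq; last by apply: contraNneq nc1 => -[->].
    by apply: acyc_sub (aB c1); apply: subsetDl.
  rewrite /blue cls_upd_same; apply: acyc_add (aB c) ej _.
  by apply/negP=> /(closed_conn cl) Eba; rewrite Eba Yl in Yu.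
have leg1 : legal col1 w m'.+1.
  move=> j /andP[j0 jm'].
  case: (leg j) => [|[m2 [u2 [m2j m2u [c2 [e2 arce2]]]]] sepj]; first by nlia.
  rewrite /reached R1; split=> //; exists m2, u2; split=> //; exists c2, e2.
  apply: (arc_upd arce2 _ cl ej Yl Yu (nY m2 u2 _ m2u) Yr); last by nlia.
  apply/negP=> /eqP Ee; case/and3P: arce2 => _ ej2 _; rewrite Ee in ej2.
  case: (joins_inj ej ej2) => -[Eu Ew].
    have jl : j < l by nlia.
    by move: (sepl j jl); rewrite Ew conn_refl.
  have m2l : m2 < l by nlia.
  by move: (sepl m2 m2l); rewrite Ew m2u.
have m'N : m' < N by nlia.
(* The new [Y] is the piece of the tail [u] in the forest [c'] from which the arrow has been
   taken. *)
have Y1r : ~~ conn (blue col1 c') u (w 0) by rewrite B1.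
have Y1u : exists y, conn (red col1) (w m') y /\ conn (blue col1 c') u y.
  by exists u; rewrite R1 conn_refl.
have [l' [f [a [b [col' [[l'm' _] fj lb aB' arcs]]]]]] :=
  IHN col1 m' c' _ m'N aB1 leg1 (@comp_closed _ u) Y1r Y1u.
by exists l', f, a, b, col'; rewrite -R1; split=> //; split; nlia.
Qed.

Lemma legal_sep col w n i j v : legal col w n -> i < n -> j < n ->
  conn (red col) (w i) v -> conn (red col) (w j) v -> i = j.
Proof.
move=> leg; wlog lt : i j / i < j => [W|] ilt jlt iv jv.
  by have [lt|lt|//] := ltngtP i j; [apply: W|apply/esym/W].
have [|_ /(_ i lt)/negP[]] := leg j; first by rewrite jlt (leq_ltn_trans _ lt).
by apply: conn_trans iv _; rewrite conn_sym.
Qed.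

Lemma legal_length col w n : legal col w n -> n <= #|V|.
Proof.
move=> leg; rewrite -[n]card_ord; apply: (leq_card (fun i : 'I_n => w i)) => i j Ew.
by apply/val_inj; apply: (@legal_sep _ _ _ i j (w i) leg) => //; rewrite Ew.
Qed.

Definition extend w n y : nat -> V := fun i => if i == n then y else w i.

Lemma extend_lt w n y i : i < n -> extend w n y i = w i.
Proof. by rewrite /extend => /ltn_eqF->. Qed.

Lemma extend_last w n y : extend w n y n = y.
Proof. by rewrite /extend eqxx. Qed.

Lemma legal_extend col w n j u y : legal col w n -> j < n ->
    conn (red col) (w j) u -> arrow col (w 0) u y ->
    (forall i, i < n -> ~~ conn (red col) (w i) y) ->
  legal col (extend w n y) n.+1.
Proof.
move=> leg jlt ju ar new i /andP[i0]; have n0 : 0 < n by apply: leq_ltn_trans jlt.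
rewrite ltnS leq_eqVlt => /predU1P[->|ilt].
  split; first by exists j, u; rewrite (extend_lt _ _ jlt) (extend_lt _ _ n0) extend_last.
  by move=> m mlt; rewrite extend_lt // extend_last; apply: new.
have [|[m [v [mi mv ar']]] sepi] := leg i; first by rewrite i0.
split; last by move=> m' m'i; rewrite !extend_lt ?sepi // (ltn_trans m'i).
by exists m, v; rewrite !extend_lt // (ltn_trans mi).
Qed.

Definition closed_exploration col w n := forall j u y, j < n ->
  conn (red col) (w j) u -> arrow col (w 0) u y -> exists i : 'I_n, conn (red col) (w i) y.

(** A consequence of having as few red edges as possible, isolated because it serves both the
    initial forest partition and the minimal configuration. *)
Definition unfillable col := forall col' f, f \in red col ->
  blue_acyc col' -> red col' = red col :\ f -> False.

(** Otherwise the vertices cut off from the root in the forest [c] form a closed set that meets an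
    explored component, and [augment] absorbs a red edge. *)
Lemma explored_conn col w n j c v :
    blue_acyc col -> unfillable col -> legal col w n -> j < n ->
  conn (red col) (w j) v -> conn (blue col c) v (w 0).
Proof.
move=> aB unf leg jn jv; apply/negPn/negP=> nv.
have [||||l [f [a [b [col' [_ [fR _] _ [aB' R'] _]]]]]] :=
  @augment col w j c (fun y => ~~ conn (blue col c) y (w 0)) aB.
- by move=> i /andP[i0 ij]; apply: leg; rewrite i0 (leq_trans ij).
- move=> e x y eF ej; apply: contra => yr.
  exact: conn_trans (conn_join eF ej) yr.
- by rewrite conn_refl.
- by exists v.
exact: unf fR aB' R'.
Qed.

End Exploration.

(** * Separating terminals of a tree by edges independent over an equivalence *)

Section Terminals.
Variables (V E : finType) (ends : E -> V * V).
Local Notation jn := (joins ends).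
Local Notation conn := (conn ends).
Local Notation component := (component ends).
Local Notation acyc := (acyc ends).
Implicit Types (F T G H : {set E}) (q : rel V) (Z : {set V}) (e g : E) (u v x y z : V).

Definition inner F q z : {set E} :=
  [set e in F | q z (ends e).1 && q z (ends e).2].

Lemma inner_joins F q z e x y : jn e x y ->
  (e \in inner F q z) = [&& e \in F, q z x & q z y].
Proof.
by move=> /orP[] /andP[/eqP <- /eqP <-]; rewrite inE // [q z _ && q z _ in RHS]andbC.
Qed.

Lemma conn_inner F q z v : q z z -> conn (inner F q z) z v -> q z v.
Proof.
move=> qz /conn_closed; apply=> // e x y eI ej _.
by move: eI; rewrite (inner_joins _ _ _ ej) => /and3P[].
Qed.

Lemma inner_exit F q z y H : equivalence_rel q -> H \subset F ->
    conn H z y -> ~~ q z y ->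
  exists g p p', [/\ g \in H /\ jn g p p', conn (inner F q z) z p, ~~ q z p'
    & conn (H :\ g) p' y].
Proof.
move=> eq sHF zy nq.
have qz : q z z by case: (eq z z z).
have [||g [p [p' [[gH gj] Bp Bp' _ p'y]]]] :=
  conn_exit (B := conn (inner F q z) z) zy.
- exact: conn_refl.
- by apply: contra nq; apply: conn_inner.
exists g, p, p'; split=> //; apply: contra Bp' => qp'.
apply: (conn_trans Bp (conn_join _ gj)).
by rewrite (inner_joins _ _ _ gj) (subsetP sHF g gH) (conn_inner qz Bp).
Qed.

(* Among the edges by which a terminal leaves its own class, one cutting off
   the fewest vertices cuts off no other terminal. *)
Lemma leaf_terminal F q Z : acyc F -> equivalence_rel q -> 1 < #|Z| ->
    {in Z &, forall z z', conn F z z'} -> {in Z &, forall z z', q z z' -> z = z'} ->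
  exists z g v v', [/\ z \in Z, g \in F /\ jn g v v', q z v /\ ~~ q z v',
    conn (F :\ g) z v & {in Z, forall z', conn (F :\ g) v z' -> z' = z}].
Proof.
move=> aF eq Z1 cZ iZ.
have qr z : q z z by case: (eq z z z).
have qs x y : q x y = q y x.
  by apply/idP/idP=> h; [rewrite -((eq x y x).2 h)|rewrite -((eq y x y).2 h)].
have qt x y z : q x y -> q y z -> q x z by move=> h; rewrite ((eq x y z).2 h).
suff main n z g v v' : #|component (F :\ g) v| < n -> z \in Z -> g \in F -> jn g v v' ->
    conn (inner F q z) z v -> ~~ q z v' -> exists z g v v',
    [/\ z \in Z, g \in F /\ jn g v v', q z v /\ ~~ q z v', conn (F :\ g) z v
      & {in Z, forall z', conn (F :\ g) v z' -> z' = z}].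
  case/card_gt1P: Z1 => z [z' [zZ z'Z nzz']].
  have [|g [p [p' [[gF gj] zp qp' _]]]] := inner_exit eq (subxx F) (cZ z z' zZ z'Z).
    by apply: contra nzz' => /(iZ z z' zZ z'Z) ->.
  exact: (main _ z g p p' (ltnSn _)).
elim: n => // n IHn in z g v v' *; rewrite ltnS => len zZ gF gj zv qv'.
have qzv := conn_inner (qr z) zv.
have innerD z1 h x x' : jn h x x' -> ~~ q z1 x -> inner F q z1 \subset F :\ h.
  move=> hj nq; apply/subsetP=> e eI; rewrite !inE.
  have -> : e \in F by move: eI; rewrite inE => /andP[].
  rewrite andbT; apply/negP=> /eqP Eh; move: eI.
  by rewrite Eh (inner_joins _ _ _ hj) (negPf nq) andbF.
have zv_g : conn (F :\ g) z v.
  by apply: conn_mono zv; apply: (innerD z g v' v) => //; rewrite joinsC.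
have [/existsP[z' /and3P[z'Z vz' nz']]|none] :=
  boolP [exists z', [&& z' \in Z, conn (F :\ g) v z' & z' != z]]; last first.
  exists z, g, v, v'; split=> // z' z'Z vz'; apply/eqP.
  by apply: contraNT none => nz'; apply/existsP; exists z'; rewrite z'Z vz'.
have nqzz' : ~~ q z' z by apply: contra nz' => /iZ->.
have z'z : conn (F :\ g) z' z.
  by rewrite conn_sym; apply: conn_trans zv_g vz'.
have [g2 [p [p' [[g2F g2j] z'p qp' p'z]]]] := inner_exit eq (subsetDl F [set g]) z'z nqzz'.
have {g2F} [ng g2F] : g2 != g /\ g2 \in F by apply/andP; move: g2F; rewrite !inE.
have qz'p := conn_inner (qr z') z'p.
apply: (IHn z' g2 p p') => //; apply: leq_trans len.
have z'p_g2 : conn (F :\ g2) z' p.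
  by apply: conn_mono z'p; apply: (innerD z' g2 p' p) => //; rewrite joinsC.
have z'p_g : conn (F :\ g) z' p.
  apply: conn_mono z'p; apply: (innerD z' g v v') => //.
  by apply: contra nqzz' => /qt; apply; rewrite qs.
have zv_g2 : conn (F :\ g2) z v.
  apply: conn_mono zv; apply: (innerD z g2 p p') => //.
  by apply: contra nqzz' => h; apply: (qt _ _ _ qz'p); rewrite qs.
have npz : ~~ conn (F :\ g2) p z.
  apply: contra (aF g2 p p' g2F g2j) => pz; apply: conn_trans pz _.
  rewrite conn_sym; apply: conn_mono p'z; apply/subsetP=> e.
  by rewrite !inE => /and3P[-> _ ->].
(* The exit edge [g2] of another terminal [z'] on the side of [v] cuts off part of that side without
   [z], hence strictly fewer vertices. *)
apply: proper_card; apply/properP; split; last first.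
  by exists z; rewrite !inE // conn_sym.
apply/subsetP=> y; rewrite !inE => py.
have vp : conn (F :\ g) v p by apply: conn_trans vz' z'p_g.
have gF2 : g \in F :\ g2 by rewrite !inE eq_sym ng.
have sub : F :\ g2 :\ g \subset F :\ g.
  by apply/subsetP=> e; rewrite !inE => /and3P[-> _ ->].
case: (conn_del gF2 gj py) => [/(conn_mono sub) py'|[/conn_subD pv _]|[/(conn_mono sub) pv' _]].
- exact: conn_trans vp py'.
- by move/negP: npz; case; apply: conn_trans pv _; rewrite conn_sym.
- by move/negP: (aF g v v' gF gj); case; apply: conn_trans vp pv'.
Qed.

(** The equivalence generated by [q] and the pair of [v] and [v']. It models inserting an edge
    between two classes. *)
Definition link q v v' : rel V :=
  fun x y => [|| q x y, q x v && q v' y | q x v' && q v y].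

Lemma link_equivalence q v v' : equivalence_rel q -> equivalence_rel (link q v v').
Proof.
move=> eq; have qr z : q z z by case: (eq z z z).
have qs x y : q x y = q y x.
  by apply/idP/idP=> h; [rewrite -((eq x y x).2 h)|rewrite -((eq y x y).2 h)].
have qt y x z : q x y -> q y z -> q x z by move=> h; rewrite ((eq x y z).2 h).
have lr z : link q v v' z z by rewrite /link qr.
have ls x y : link q v v' x y -> link q v v' y x.
  rewrite /link => /or3P[h|/andP[h1 h2]|/andP[h1 h2]].
  - by rewrite qs h.
  - by rewrite (qs y v') h2 (qs v x) h1 !orbT.
  - by rewrite (qs y v) h2 (qs v' x) h1 !orbT.
have lt y x z : link q v v' x y -> link q v v' y z -> link q v v' x z.
  rewrite /link => /or3P[h|/andP[h1 h2]|/andP[h1 h2]] /or3P[h'|/andP[h3 h4]|/andP[h3 h4]].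
  - by rewrite (qt _ _ _ h h').
  - by rewrite (qt _ _ _ h h3) h4 !orbT.
  - by rewrite (qt _ _ _ h h3) h4 !orbT.
  - by rewrite h1 (qt _ _ _ h2 h') !orbT.
  - by rewrite (qt _ _ _ h1 (qt _ _ _ _ h4)) // qs (qt _ _ _ h2 h3).
  - by rewrite (qt _ _ _ h1 h4).
  - by rewrite h1 (qt _ _ _ h2 h') !orbT.
  - by rewrite (qt _ _ _ h1 h4).
  - by rewrite (qt _ _ _ h1 (qt _ _ _ _ h4)) // qs (qt _ _ _ h2 h3).
move=> x y z; split=> // xy; apply/idP/idP; last exact: lt.
by apply: lt; apply: ls.
Qed.

(** [G] is a forest modulo [q], expressed through the forests [T] whose components refine [q]. By
    the second clause, [G] does not join two vertices of one class that [T] keeps apart. *)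
Definition independent_over q G := forall T, acyc T ->
  (forall x y, conn T x y -> q x y) ->
  acyc (T :|: G) /\ (forall a b, q a b -> ~~ conn T a b -> ~~ conn (T :|: G) a b).

(** Induction on [Z]: detach a leaf terminal [z] at its exit edge [g] and merge the classes of the
    two ends of [g] for the remaining terminals. As these ends lie in different classes, [g |: T] is
    a forest whose components refine the merged classes, so the induction hypothesis applies to
    it. *)
Lemma split_terminals F q Z : acyc F -> equivalence_rel q -> 0 < #|Z| ->
    {in Z &, forall z z', conn F z z'} -> {in Z &, forall z z', q z z' -> z = z'} ->
    (forall z v, z \in Z -> conn F z v -> exists2 z', z' \in Z & q v z') ->
  exists G, [/\ G \subset F /\ #|G|.+1 = #|Z|,
    (forall e x y z, e \in G -> jn e x y -> z \in Z -> conn F z x),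
    (forall z v, z \in Z -> conn F z v -> exists2 z', z' \in Z & conn (F :\: G) z' v),
    {in Z &, forall z z', conn (F :\: G) z z' -> z = z'}
  & independent_over q G].
Proof.
have [n] := ubnP #|Z|; elim: n => // n IHn in F q Z *.
rewrite ltnS => leZn aF eq Z0 cZ iZ covZ.
have qr z : q z z by case: (eq z z z).
have qs x y : q x y = q y x.
  by apply/idP/idP=> h; [rewrite -((eq x y x).2 h)|rewrite -((eq y x y).2 h)].
have qt y x z : q x y -> q y z -> q x z by move=> h; rewrite ((eq x y z).2 h).
have [Z1|] := leqP #|Z| 1.
  have {Z0 Z1} /cards1P[z EZ] : #|Z| == 1 by rewrite eqn_leq Z1.
  exists set0; split.
  - by rewrite sub0set cards0 EZ cards1.
  - by move=> e x y z'; rewrite inE.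
  - by move=> z' v z'Z zv; exists z'; rewrite ?setD0.
  - by move=> z1 z2; rewrite EZ !inE => /eqP-> /eqP->.
  - by move=> T aT _; rewrite setU0.
move=> Z1; have [z [g [v [v' [zZ [gF gj] [qzv qzv'] zv leaf]]]]] :=
  leaf_terminal aF eq Z1 cZ iZ.
have nvv' : ~~ q v v' by apply: contra qzv'; apply: qt.
pose F1 := F :\ g; pose Z' := Z :\ z; pose q1 := link q v v'.
have Zz z1 : z1 \in Z' -> z1 \in Z /\ z1 != z by move=> /setD1P[].
have nleaf z1 : z1 \in Z' -> ~~ conn F1 v z1.
  by move=> /Zz[z1Z nz1]; apply: contra nz1 => /leaf->.
have aF1 : acyc F1 by apply: acyc_sub aF; apply: subsetDl.
have cardZ' : #|Z| = #|Z'|.+1 by rewrite (cardsD1 z) zZ.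
have z1v' z1 : z1 \in Z' -> conn F1 z1 v'.
  move=> z1Z'; have [z1Z nz1] := Zz _ z1Z'.
  have : conn F z1 v'.
    apply: conn_trans (cZ _ _ z1Z zZ) _; apply: conn_trans (conn_subD zv) _.
    exact: conn_join gF gj.
  case/(conn_del gF gj) => [//|[]|[] //]; rewrite conn_sym => h.
  by move: (nleaf _ z1Z'); rewrite /F1 h.
have [|||||G1 [[sG1 cG1] inG1 pieces1 sep1 ind1]] :=
  IHn F1 q1 Z' _ aF1 (link_equivalence v v' eq).
- by rewrite -ltnS -cardZ'.
- by rewrite -ltnS -cardZ'.
- move=> z1 z2 z1Z' z2Z'; apply: conn_trans (z1v' _ z1Z') _.
  by rewrite conn_sym z1v'.
- move=> z1 z2 z1Z' z2Z'; have [z1Z nz1] := Zz _ z1Z'; have [z2Z nz2] := Zz _ z2Z'.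
  case/or3P=> [|/andP[h _]|/andP[_ h]]; first exact: iZ.
    by case/eqP: nz1; apply: iZ => //; apply: qt h _; rewrite qs.
  by case/eqP: nz2; apply: iZ => //; rewrite qs; apply: qt qzv h.
- move=> z1 y z1Z' z1y; have [z1Z nz1] := Zz _ z1Z'.
  have [z2 z2Z qy] := covZ _ _ z1Z (conn_subD z1y).
  (* A vertex represented by the removed [z] is equivalent to [v]; after the merge, a terminal in
     the class of [v'] represents it. *)
  have [Ez2|nz2] := eqVneq z2 z; last first.
    by exists z2; rewrite ?inE ?nz2 // /q1 /link qy.
  have [z3 z3Z qv'] := covZ _ _ z1Z (conn_subD (z1v' _ z1Z')).
  have qyv : q y v by apply: (qt z) => //; rewrite -Ez2.
  exists z3; last by rewrite /q1 /link qyv qv' orbT.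
  by rewrite !inE z3Z andbT; apply: contra qzv' => /eqP <-; rewrite qs.
have gG1 : g \notin G1 by apply/negP=> /(subsetP sG1); rewrite !inE eqxx.
have ED : F :\: (g |: G1) = F1 :\: G1.
  by apply/setP=> e; rewrite !inE negb_or -andbA andbCA.
exists (g |: G1); rewrite ED; split.
- rewrite cardsU1 gG1 add1n cG1 -cardZ'; split=> //.
  rewrite subUset sub1set gF; apply: subset_trans sG1 _; exact: subsetDl.
- move=> e x y z' eG ej z'Z; have [z1 z1Z'] : exists z1, z1 \in Z'.
    by apply/card_gt0P; rewrite -ltnS -cardZ'.
  have [z1Z _] := Zz _ z1Z'.
  apply: conn_trans (cZ _ _ z'Z z1Z) _; case/setU1P: eG => [Ee|eG1]; last first.
    exact: conn_subD (inG1 _ _ _ _ eG1 ej z1Z').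
  have z1v : conn F z1 v.
    apply: conn_trans (conn_subD (z1v' _ z1Z')) _.
    by rewrite conn_sym (conn_join gF).
  by rewrite Ee in ej; case: (joins_inj gj ej) => [[<- _]|[_ <-]] //;
    apply: conn_subD (z1v' _ z1Z').
- move=> z' y z'Z z'y.
  have [z1 z1Z'] : exists z1, z1 \in Z'.
    by apply/card_gt0P; rewrite -ltnS -cardZ'.
  have [z1Z _] := Zz _ z1Z'.
  have vy : conn F v y.
    apply: conn_trans z'y; rewrite conn_sym; apply: conn_trans (cZ _ _ z'Z zZ) _.
    exact: conn_subD zv.
  have [vy1|v'y1] : conn F1 v y \/ conn F1 v' y.
    by case/(conn_del gF gj): vy => [|[]|[]]; auto.
    exists z => //; have zy : conn F1 z y by apply: conn_trans zv vy1.
    apply: conn_local zy => e a b eF1 ej za; rewrite inE eF1 andbT.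
    apply/negP=> eG1; have z1a := inG1 _ _ _ _ eG1 ej z1Z'.
    move/negP: (nleaf _ z1Z'); apply; apply: (@conn_trans _ _ _ _ z); first by rewrite conn_sym.
    by apply: conn_trans za _; rewrite conn_sym.
  have [z2 z2Z' z2y] := pieces1 _ _ z1Z' (conn_trans (z1v' _ z1Z') v'y1).
  by exists z2 => //; case: (Zz _ z2Z').
- have zsep z1 : z1 \in Z -> conn (F1 :\: G1) z z1 -> z1 = z.
    move=> z1Z /conn_subD h; apply: leaf => //.
    by apply: conn_trans h; rewrite conn_sym.
  move=> z1 z2 z1Z z2Z h; have [E1|n1] := eqVneq z1 z.
    by rewrite E1 in h *; rewrite (zsep z2).
  have [E2|n2] := eqVneq z2 z.
    by rewrite E2 in h *; apply: zsep => //; rewrite conn_sym.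
  by apply: sep1; rewrite ?inE ?n1 ?n2.
- move=> T aT Tq.
  have aT1 : acyc (g |: T) by apply: acyc_add aT gj _; apply: contra nvv' => /Tq.
  have ET : T :|: (g |: G1) = (g |: T) :|: G1 by rewrite setUCA setUA.
  have [|aU nU] := ind1 _ aT1.
    by move=> x y /(conn_add gj)[/Tq h|[/Tq h1 /Tq h2]|[/Tq h1 /Tq h2]];
      rewrite /q1 /link ?h ?h1 ?h2 ?orbT.
  rewrite ET; split=> // a b qab nab; apply: nU; first by rewrite /q1 /link qab.
  apply/negP=> /(conn_add gj)[|[/Tq h1 /Tq h2]|[/Tq h1 /Tq h2]].
  - exact/negP.
  - move/negP: nvv'; apply; apply: (qt a); first by rewrite qs.
    by apply: qt qab _; rewrite qs.
  - move/negP: nvv'; apply; apply: (qt _ _ _ h2).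
    by apply: (qt a) => //; rewrite qs.
Qed.

End Terminals.

Lemma sum_card_disjoint (I T : finType) (Z : {set I}) (P : I -> {set T}) (A : {set T}) :
    {in Z, forall z, P z \subset A} ->
    {in Z &, forall z z', forall u, u \in P z -> u \in P z' -> z = z'} ->
  \sum_(z in Z) #|P z| <= #|A|.
Proof.
move=> sPA disj.
have cardP z : z \in Z -> #|P z| = \sum_(u in A) (u \in P z).
  move=> zZ; rewrite -sum1_card big_mkcond [RHS]big_mkcond /=.
  apply: eq_bigr => u _; case: (boolP (u \in P z)) => [uP|_]; last by case: ifP.
  by rewrite (subsetP (sPA z zZ)).
rewrite (eq_bigr _ cardP) exchange_big /= -sum1_card; apply: leq_sum => u _.
have [/existsP[z /andP[zZ uz]]|none] := boolP [exists z in Z, u \in P z].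
  rewrite (bigD1 z) //= big1 ?addn0; first by rewrite uz.
  move=> z' /andP[z'Z nz]; apply/eqP; rewrite eqb0; apply: contra nz => uz'.
  by apply/eqP; apply: disj uz.
rewrite big1 // => z zZ; apply/eqP; rewrite eqb0; apply: contra none => uz.
by apply/existsP; exists z; rewrite zZ.
Qed.

(** * Total excess of the red components and its change under relabelling *)

Section Excess.
Variables (V E : finType) (ends : E -> V * V) (D : nat).
Local Notation jn := (joins ends).
Local Notation conn := (conn ends).
Local Notation component := (component ends).
Local Notation acyc := (acyc ends).
Implicit Types (F : {set E}) (s : V -> V) (e f g : E) (u v x y z r : V).

(** Surplus over [D] edges of a tree with [n] vertices, truncated at zero. *)
Definition excess (n : nat) := n.-1 - D.

Definition fiber s v : {set V} := [set u | s u == v].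

Definition rep F v := fingraph.root (adjF ends F) v.

(** A vertex that represents no component has an empty fiber and contributes zero, so this is a sum
    over the components. *)
Definition total_excess F := \sum_v excess #|fiber (rep F) v|.

Lemma excess_mono m n : m <= n -> excess m <= excess n.
Proof. rewrite /excess; lia. Qed.

Lemma excess_add m n : excess m + excess n <= excess (m + n).
Proof. rewrite /excess; lia. Qed.

Lemma conn_rep F v : conn F v (rep F v).
Proof. exact: connect_root. Qed.

Lemma rep_eq F u v : (rep F u == rep F v) = conn F u v.
Proof. exact/root_connect/sym_connect_sym/adjF_sym. Qed.

Lemma fiber_rep F v : fiber (rep F) (rep F v) = component F v.
Proof. by apply/setP=> u; rewrite !inE rep_eq conn_sym. Qed.

Lemma card_fiber s v : #|fiber s v| = \sum_(u | s u == v) 1.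
Proof. by rewrite sum1_card; apply: eq_card => u; rewrite !inE. Qed.

(** The fibers of [s] are unions of components, and [excess] is superadditive. *)
Lemma total_excess_le F s : (forall x y, conn F x y -> s x = s y) ->
  total_excess F <= \sum_v excess #|fiber s v|.
Proof.
move=> cs; rewrite /total_excess (partition_big s xpredT) //=.
apply: leq_sum => v _.
apply: (@leq_trans (excess (\sum_(i | s i == v) #|fiber (rep F) i|))).
  elim/big_rec2: _ => [//|i m n _ le]; apply: leq_trans (excess_add _ _).
  by rewrite leq_add2l.
apply: excess_mono.
rewrite card_fiber [X in _ <= X](partition_big (rep F) (fun i => s i == v)) /=; last first.
  by move=> u /eqP <-; rewrite (cs _ _ (conn_rep F u)).
apply: leq_sum => i /eqP <-; rewrite card_fiber leq_eqVlt; apply/orP; left.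
apply/eqP/eq_bigl => u; case: (rep F u =P i) => [<-|]; last by rewrite andbF.
by rewrite andbT (cs _ _ (conn_rep F u)) eqxx.
Qed.

Lemma total_excess_sub (F F' : {set E}) :
  F' \subset F -> total_excess F' <= total_excess F.
Proof.
move=> sF; apply: total_excess_le => x y xy.
by apply/eqP; rewrite rep_eq (conn_mono sF).
Qed.

(* [s] refines the component of [z0] (with labels inside it), and may absorb
   other components of [F] into the refined pieces. *)
Lemma total_excess_relabel F F' z0 s :
    (forall x y, conn F' x y -> s x = s y) ->
    (forall v, s v \notin component F z0 -> s v = rep F v) ->
  total_excess F' + excess #|component F z0| <=
  total_excess F + \sum_(v in component F z0) excess #|fiber s v|.
Proof.
move=> cs sout.
apply: leq_trans (leq_add (total_excess_le cs) (leqnn _)) _.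
rewrite /total_excess (bigID (mem (component F z0)) predT) /=.
rewrite [X in _ <= X + _](bigID (mem (component F z0)) predT) /=.
have z0C : rep F z0 \in component F z0 by rewrite inE conn_rep.
rewrite -addnA addnC leq_add2r addnC leq_add //.
  by rewrite (bigD1 (rep F z0)) //= fiber_rep leq_addr.
apply: leq_sum => v vC; apply: excess_mono; apply: subset_leq_card.
by apply/subsetP=> u; rewrite !inE => /eqP Eu; rewrite -sout Eu.
Qed.

(** Both sides of [f] are nonempty and together have one edge fewer, so their excesses sum to
    strictly less than that of the oversized component. *)
Lemma total_excess_cut F f a b : f \in F -> jn f b a ->
    ~~ conn (F :\ f) b a -> D < #|component F b|.-1 ->
  total_excess (F :\ f) < total_excess F.
Proof.
move=> fF fj nba big.
pose s v := if conn F b v then if conn (F :\ f) b v then b else a else rep F v.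
have ba : conn F b a by apply: conn_join fj.
have sin v : conn F b (s v) = conn F b v.
  rewrite /s; case: (boolP (conn F b v)) => [_|nv]; first by case: ifP; rewrite ?ba ?conn_refl.
  by apply/negbTE; apply: contra nv => h; apply: conn_trans h _; rewrite conn_sym conn_rep.
have le : total_excess (F :\ f) + excess #|component F b| <=
    total_excess F + \sum_(v in component F b) excess #|fiber s v|.
  apply: total_excess_relabel => [x y xy|v]; last by rewrite inE sin /s => /negbTE->.
  have xy' := conn_subD xy; rewrite /s.
  have -> : conn F b x = conn F b y.
    by apply/idP/idP=> h; [exact: conn_trans h xy'|apply: conn_trans h _; rewrite conn_sym].
  have -> : conn (F :\ f) b x = conn (F :\ f) b y.
    by apply/idP/idP=> h; [exact: conn_trans h xy|apply: conn_trans h _; rewrite conn_sym].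
  by case: ifP => // _; apply/eqP; rewrite rep_eq.
suff : \sum_(v in component F b) excess #|fiber s v| < excess #|component F b|.
  by move: le; rewrite -/(total_excess F); nlia.
have nab : a != b by apply: contra nba => /eqP->.
rewrite (bigD1 b) ?inE ?conn_refl //= (bigD1 a) ?inE ?ba //= big1 ?addn0; last first.
  move=> v /andP[/andP[vC nb] na]; suff -> : fiber s v = set0 by rewrite cards0.
  apply/setP=> u; rewrite !inE; apply/negbTE/negP=> /eqP Eu.
  have bu : conn F b u by move: vC; rewrite inE -Eu sin.
  by move: nb na; rewrite -Eu /s bu; case: ifP; rewrite eqxx.
have disj : fiber s b :&: fiber s a = set0.
  apply/setP=> u; rewrite !inE; case: (s u =P b) => // ->.
  by rewrite eq_sym (negPf nab).
have sub : fiber s b :|: fiber s a \subset component F b.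
  by apply/subsetP=> u; rewrite !inE -sin => /orP[] /eqP-> //; apply: conn_refl.
have b0 : 0 < #|fiber s b|.
  by apply/card_gt0P; exists b; rewrite inE /s !conn_refl.
have a0 : 0 < #|fiber s a|.
  by apply/card_gt0P; exists a; rewrite inE /s ba (negPf nba).
move: (subset_leq_card sub) (cardsUI (fiber s b) (fiber s a)); rewrite disj cards0 /excess.
move: #|fiber s b| #|fiber s a| #|component F b| #|_ :|: _| b0 a0 big => m n p q; clear; lia.
Qed.

End Excess.

(** * Centroids of large trees *)

Section Centroid.
Variables (V E : finType) (ends : E -> V * V).
Local Notation jn := (joins ends).
Local Notation conn := (conn ends).
Local Notation component := (component ends).
Local Notation acyc := (acyc ends).
Implicit Types (F : {set E}) (e f : E) (u v r : V).

Definition central F n r := forall f, n < #|component (F :\ f) r|.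

(* A small side of largest size could be enlarged across its cut edge. *)
Lemma central_exists F n v : acyc F -> n.*2 < #|component F v| ->
  exists2 r, conn F v r & central F n r.
Proof.
move=> aF big.
have [/existsP[r /andP[vr /forallP h]]|none] :=
  boolP [exists r, conn F v r && [forall f, n < #|component (F :\ f) r|]].
  by exists r.
have {none} none r : conn F v r -> exists f, #|component (F :\ f) r| <= n.
  move=> vr; apply/existsP; apply: contraNT none; rewrite negb_exists => /forallP h.
  apply/existsP; exists r; rewrite vr; apply/forallP=> f.
  by move: (h f); rewrite -ltnNge.
exfalso.
suff main m r f : conn F v r -> #|component (F :\ f) r| <= n ->
    n < #|component (F :\ f) r| + m -> False.
  have [f hf] := none v (conn_refl _ _ _).
  apply: (main n.+1 v f) => //.
  by rewrite addnS ltnS leq_addl.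
elim: m => [|m IHm] in r f *; first by rewrite addn0 ltnNge => _ ->.
move=> vr small lt.
have compK u : conn F v u -> component F u = component F v.
  move=> vu; apply/setP=> x; rewrite !inE; apply/idP/idP=> h; first exact: conn_trans h.
  by apply: conn_trans h; rewrite conn_sym.
have fF : f \in F.
  apply/negPn/negP=> nfF; move: small.
  have -> : F :\ f = F by apply/setDidPl; rewrite disjoint_sym disjoints1.
  by rewrite compK // leqNgt; case/negP; lia.
have [b [a [fj rb]]] : exists b a, jn f b a /\ conn (F :\ f) r b.
  have ej := joins_ends ends f.
  case: (boolP (conn (F :\ f) r (ends f).1)) => h1.
    by exists (ends f).1, (ends f).2.
  case: (boolP (conn (F :\ f) r (ends f).2)) => h2.
    by exists (ends f).2, (ends f).1; rewrite joinsC.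
  suff Er : component (F :\ f) r = component F r.
    by move: small; rewrite Er compK // leqNgt; case/negP; lia.
  apply/setP=> x; rewrite !inE; apply/idP/idP=> [|]; first exact: conn_subD.
  by case/(conn_del fF ej) => [//|[]|[]]; rewrite ?(negPf h1) ?(negPf h2).
have nba := aF f b a fF fj.
have va : conn F v a.
  by apply: conn_trans vr _; apply: conn_trans (conn_subD rb) (conn_join fF fj).
have sides : component F v \subset component (F :\ f) r :|: component (F :\ f) a.
  apply/subsetP=> x; rewrite -(compK _ va) !inE conn_sym.
  case/(conn_del fF fj) => [xa|[xb _]|[xa _]].
  - by rewrite [conn _ a x]conn_sym xa orbT.
  - by rewrite (conn_trans rb) // conn_sym.
  - by rewrite [conn _ a x]conn_sym xa orbT.
have bigA : n < #|component (F :\ f) a|.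
  move: (subset_leq_card sides) (cardsUI (component (F :\ f) r) (component (F :\ f) a)).
  by move: small big; clear; lia.
have [f' small'] := none a va.
have nf : f' != f by apply: contraTneq small' => ->; rewrite -ltnNge.
(* If [f'] touches the side of [r], its deletion leaves the whole side of [a] connected, which has
   more than [n] vertices. Otherwise the small side at [a] contains [a] and the entire side of [r],
   so it is larger than the previous one. *)
case: (boolP [exists x, conn (F :\ f) r x && ((ends f').1 == x) || conn (F :\ f) r x && ((ends f').2 == x)]).
  case/existsP=> x hx.
  have touch : exists y, jn f' x y.
    case/orP: hx => /andP[_ /eqP <-]; last exists (ends f').1; last by rewrite joinsC joins_ends.
    by exists (ends f').2; apply: joins_ends.
  have {hx} rx : conn (F :\ f) r x by case/orP: hx => /andP[].
  have {touch} [y f'j] := touch.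
  suff /subset_leq_card : component (F :\ f) a \subset component (F :\ f') a.
    by move: bigA small'; clear; lia.
  apply/subsetP=> z; rewrite !inE; apply: conn_local => e p p' eF ej ap.
  move: (eF); rewrite !inE => /andP[_ ->]; rewrite andbT; apply/negP=> /eqP Ee.
  rewrite Ee in ej eF.
  have ax : conn (F :\ f) a x.
    case: (joins_inj f'j ej) => [[-> _] //|[-> _]].
    by apply: conn_trans ap (conn_join eF ej).
  move/negP: nba; apply; rewrite conn_sym; apply: conn_trans ax _.
  by apply: conn_trans rb; rewrite conn_sym.
rewrite negb_exists => /forallP untouched.
apply: (IHm a f') => //.
suff /subset_leq_card : a |: component (F :\ f) r \subset component (F :\ f') a.
  rewrite cardsU1 inE.
  have -> : ~~ conn (F :\ f) r a.
    by apply: contra nba => ra; apply: conn_trans ra; rewrite conn_sym.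
  by move: lt; clear; lia.
apply/subsetP=> z; rewrite !inE => /predU1P[->|rz]; first exact: conn_refl.
have ab : conn (F :\ f') a b.
  by apply: (@conn_join _ _ _ _ f); rewrite ?inE ?fF ?andbT 1?eq_sym // joinsC.
have loc x : conn (F :\ f) r x -> conn (F :\ f') r x.
  apply: conn_local => e p p' eF ej rp; move: (eF); rewrite !inE => /andP[_ ->].
  rewrite andbT; apply/negP=> /eqP Ee; rewrite Ee in ej.
  move: (untouched p); rewrite rp /=.
  by case/orP: ej => /andP[h1 h2]; rewrite ?h1 ?h2 ?orbT.
apply: conn_trans ab _; apply: conn_trans (loc z rz).
by rewrite conn_sym loc.
Qed.

End Centroid.

(** * Lexicographic comparison by a single number *)

Section LexCode.
Variable B : nat.

(** A positional number in base [B], with [s 0] as the most significant digit. *)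
Fixpoint lex_code n (s : nat -> nat) :=
  if n is m.+1 then lex_code m s * B + s m else 0.

Lemma lex_code_lt n s s' l : l < n -> (forall j, s' j < B) ->
  (forall j, j < l -> s' j = s j) -> s' l < s l -> lex_code n s' < lex_code n s.
Proof.
move=> ln bs eqs lts.
have Eq m : m <= l -> lex_code m s' = lex_code m s.
  by elim: m => //= m IHm ml; rewrite IHm ?eqs // ltnW.
elim: n ln => // n IHn; rewrite ltnS leq_eqVlt => /predU1P[<-|/IHn lt] /=.
  by rewrite Eq // ltn_add2l.
apply: (@leq_trans ((lex_code n s').+1 * B)); last first.
  by apply: leq_trans (leq_addr _ _); rewrite leq_mul2r lt orbT.
by rewrite mulSn addnC -addSn leq_add2r.
Qed.

End LexCode.

(** * Minimal configurations and what their optimality forbids *)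

Section MinimalConfiguration.
Variables (V E : finType) (ends : E -> V * V) (K D N : nat).
Local Notation jn := (joins ends).
Local Notation conn := (conn ends).
Local Notation component := (component ends).
Local Notation acyc := (acyc ends).
Local Notation arc_via := (arc_via ends).
Local Notation total_excess := (total_excess ends D).
Local Notation excess := (excess D).
Local Notation legal := (legal ends).
Local Notation blue_acyc := (blue_acyc ends).
Implicit Types (col : E -> option 'I_K) (w : nat -> V).

Definition valid col := blue_acyc col /\ acyc (red col).

Definition no_worse col' col := [/\ valid col', #|red col'| <= #|red col|
  & total_excess (red col') <= total_excess (red col)].

Definition config col w n := [/\ legal col w n, 0 < n,
  central ends (red col) N (w 0) & D < #|component (red col) (w 0)|.-1].

(** Positions past the end carry a digit larger than any component size, so extending an exploration
    lowers its code. By [legal_length] there is always such a position. *)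
Definition code col w n := lex_code #|V|.+2 #|V|.+1
  (fun j => if j < n then #|component (red col) (w j)| else #|V|.+1).

(** The last clause ranges over all colourings that tie with [col] in the first two measures, and
    not only over explorations of [col]. *)
Definition minimal col w n := [/\ valid col, config col w n,
  forall col', valid col' -> #|red col| <= #|red col'|,
  forall col', valid col' -> #|red col'| <= #|red col| ->
    total_excess (red col) <= total_excess (red col')
  & forall col' w' n', no_worse col' col -> config col' w' n' ->
    code col w n <= code col' w' n'].

Variables (col : E -> option 'I_K) (w : nat -> V) (n : nat).
Hypothesis min : minimal col w n.
Local Notation R := (red col).
Local Notation r := (w 0).

Let val : valid col. Proof. by case: min. Qed.
Let leg : legal col w n. Proof. by case: min => _ []. Qed.
Let aB : blue_acyc col. Proof. by case: val. Qed.
Let aR : acyc R. Proof. by case: val. Qed.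

Lemma sep_lt i j : i < j -> j < n -> ~~ conn R (w i) (w j).
Proof. by move=> ij jn; case: (leg (j := j)) => [|_]; [lia | apply]. Qed.

Lemma sep i j v : i < n -> j < n -> conn R (w i) v -> conn R (w j) v -> i = j.
Proof. exact: legal_sep leg. Qed.

Lemma minimal_unfillable : unfillable ends col.
Proof.
move=> col' f fR aB' Er.
case: min => _ _ minR _ _; have /minR : valid col'.
  by split=> //; rewrite Er; apply: acyc_sub aR; apply: subsetDl.
by rewrite Er [X in X <= _](cardsD1 f) fR ltnn.
Qed.

Lemma blue_conn c j v : j < n -> conn R (w j) v -> conn (blue col c) v r.
Proof. exact: (explored_conn _ aB minimal_unfillable leg). Qed.

Lemma component_le F v : #|component F v| <= #|V|.
Proof. exact: max_card. Qed.

(** The prefix up to [w l] is a configuration for [col']. The digits before position [l] are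
    unchanged and the digit at [l] drops, which contradicts the minimality of the code. *)
Lemma prefix_optimal col' l : 0 < l < n -> no_worse col' col ->
    (forall j e x y, j < l -> jn e x y -> conn R (w j) x -> (e \in R) = (e \in red col')) ->
    (forall j, 0 < j <= l -> exists m u,
      [/\ m < j, conn R (w m) u & arrow ends col' r u (w j)]) ->
    #|component (red col') (w l)| < #|component R (w l)| ->
  False.
Proof.
move=> /andP[l0 ln] nw agree arcs smaller.
have same j v : j < l -> conn (red col') (w j) v = conn R (w j) v.
  by move=> jl; apply: conn_agree => e x y; apply: agree.
have sameC j : j < l -> component (red col') (w j) = component R (w j).
  by move=> jl; apply/setP=> v; rewrite !inE same.
case: min => _ [_ _ cen big] _ _ /(_ col' w l.+1 nw) minc.
suff cfg : config col' w l.+1.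
  move: (minc cfg); apply/negP; rewrite -ltnNge /code.
  apply: (@lex_code_lt _ _ _ _ l).
  - by rewrite ltnS; apply: leq_trans (ltnW ln) (legal_length leg).
  - by move=> j; case: ifP => // _; rewrite ltnS; apply/leqW/component_le.
  - by move=> j jl; rewrite (ltn_trans jl ln) (ltn_trans jl (ltnSn l)) sameC.
  - by rewrite ltnSn ln.
split=> //.
- move=> j /andP[j0 jl]; split; last first.
    move=> m mj; rewrite same; last exact: leq_trans mj jl.
    by apply: sep_lt => //; apply: leq_ltn_trans ln.
  have [|m [u [mj mu a]]] := arcs j; first by rewrite j0 -ltnS.
  by exists m, u; split=> //; rewrite same //; apply: leq_trans mj jl.
- move=> f; apply: leq_trans (cen f) _; apply: subset_leq_card.
  apply/subsetP=> v; rewrite !inE; apply: conn_local => e x y.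
  rewrite !in_setD1 => /andP[ne eR] ej /conn_subD rx.
  by rewrite ne -(agree 0 e x y).
- by rewrite sameC.
Qed.

(** * Exchange of the edges towards several children for red edges of the parent *)

Section Swap.
Variables (t : nat) (c : 'I_K) (J : {set 'I_n}) (ee : 'I_n -> E) (uu : 'I_n -> V).
Hypotheses (ht : 0 < t < n) (J0 : 0 < #|J|) (Jt : {in J, forall m : 'I_n, t < m}).
Hypothesis uuR : {in J, forall m, conn R (w t) (uu m)}.
Hypothesis arcJ : {in J, forall m : 'I_n, arc_via col r c (ee m) (uu m) (w m)}.
(** After the exchange the child [m] hangs on the piece of its tail, of size [p m]; [p0] stands for
    a possible further piece around [w t] that carries no child. *)
Hypothesis numeric : forall (p : 'I_n -> nat) p0, {in J, forall m, 0 < p m} ->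
  p0 + \sum_(m in J) p m <= #|component R (w t)| ->
  excess p0 + \sum_(m in J) excess (p m + #|component R (w m)|)
    <= excess #|component R (w t)|.

Let X := ee @: J.
Let T0 := blue col c :\: X.

Let tn : t < n. Proof. by case/andP: ht. Qed.

Let eeB m : m \in J -> ee m \in blue col c.
Proof. by move=> /arcJ/and3P[]. Qed.

Let eej m : m \in J -> jn (ee m) (uu m) (w m).
Proof. by move=> /arcJ/and3P[]. Qed.

Let eeout m : m \in J -> ~~ conn (blue col c :\ ee m) (uu m) r.
Proof. by move=> /arcJ/and3P[]. Qed.

Let sX : X \subset blue col c.
Proof. by apply/subsetP=> e /imsetP[m mJ ->]; apply: eeB. Qed.

Let eeX m : m \in J -> ee m \in X.
Proof. by move=> mJ; apply: imset_f. Qed.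

Let uuRm (m m' : 'I_n) : m \in J -> m' \in J -> ~~ conn R (w m') (uu m).
Proof.
move=> mJ m'J; apply/negP=> h; have := sep tn (ltn_ord m') (uuR mJ) h => Et.
by move: (Jt m'J); rewrite -Et ltnn.
Qed.

Let ee_inj : {in J &, injective ee}.
Proof.
move=> m m' mJ m'J Ee; apply/val_inj.
have j := eej mJ; rewrite Ee in j; case: (joins_inj j (eej m'J)) => [[_ Ew]|[Eu _]].
  by apply: (@sep m m' (w m)) => //; rewrite Ew conn_refl.
by have := uuRm mJ m'J; rewrite Eu conn_refl.
Qed.

Let cardX : #|X| = #|J|.
Proof. exact: card_in_imset. Qed.

Let uur m : m \in J -> conn (blue col c) (uu m) r.
Proof. by move=> mJ; apply: (blue_conn _ tn (uuR mJ)). Qed.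

Let uu_sep : {in J &, forall m m', conn T0 (uu m) (uu m') -> m = m'}.
Proof.
move=> m m' mJ m'J h; apply/eqP/negPn/negP=> ne.
have nee : ee m != ee m' by apply: contra ne => /eqP/ee_inj->.
have := out_edges_separate (@aB c) (uur mJ) (uur m'J) (eeB mJ) (eeB m'J) (eej mJ)
  (eej m'J) (eeout mJ) (eeout m'J) nee.
apply/negP/negPn; apply: conn_mono h; apply/subsetP=> e; rewrite !in_setD1 inE.
case/andP=> eX ->; rewrite andbT; apply/andP; split; apply: contraNneq eX => ->; exact: eeX.
Qed.

Let uu_inj : {in J &, injective uu}.
Proof. by move=> m m' mJ m'J Eu; apply: uu_sep; rewrite ?Eu. Qed.

Let uu_cut m : m \in J -> ~~ conn T0 (uu m) r.
Proof.
move=> mJ; apply: contra (eeout mJ); apply: conn_mono; apply: setDS.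
by rewrite sub1set eeX.
Qed.

(** The path from [v] to [r] leaves the piece of [v] through an edge of [X], and it does so at the
    tail of that edge. *)
Let cover v : conn (blue col c) v r -> conn T0 v r \/ exists2 m, m \in J & conn T0 v (uu m).
Proof.
move=> vr; have [|nvr] := boolP (conn T0 v r); [by left | right].
have [|g [p [q [[gB gj] vp nvq _ qr]]]] := conn_exit (B := conn T0 v) vr _ nvr.
  exact: conn_refl.
have /imsetP[m mJ Eg] : g \in X.
  apply: contraNT nvq => gX; apply: conn_trans vp (conn_join _ gj).
  by rewrite inE gX.
exists m => //; rewrite Eg in gj; case: (joins_inj (eej mJ) gj) => [[-> _] //|[Eu _]].
by move: (eeout mJ); rewrite Eu -Eg qr.
Qed.

Section Pieces.
Variable G : {set E}.
Hypothesis sG : G \subset R.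
Hypothesis aT : acyc (T0 :|: G).

Let col2 := recolor col c X G.
Let R2 : red col2 = (R :\: G) :|: X. Proof. exact: red_recolor. Qed.

Lemma swap_blue_acyc : blue_acyc col2.
Proof.
move=> c'; have [->|nc] := eqVneq c' c; first by rewrite blue_recolor.
by rewrite blue_recolor_neq.
Qed.

(** The old red component of [w m] serves as the cut of [ee m]: red edges respect it, and the other
    edges of [X] lead from the component of [w t] to other children. *)
Lemma swap_red_acyc : acyc (red col2).
Proof.
rewrite R2; apply: (acyc_add_cuts
  (Y := fun e v => [exists m in J, (ee m == e) && conn R (w m) v])).
- by apply: acyc_sub aR; apply: subsetDl.
- move=> e /imsetP[m mJ ->]; exists (w m), (uu m); split.
  + by rewrite joinsC eej.
  + by apply/existsP; exists m; rewrite mJ eqxx conn_refl.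
  + apply/negP=> /existsP[m' /and3P[m'J _ h]].
    by move: (uuRm mJ m'J); rewrite h.
- move=> e e' x y eX e'U ne ej /existsP[m /and3P[mJ /eqP Ee mx]].
  apply/existsP; exists m; rewrite mJ Ee eqxx /=.
  case/setUP: e'U => [/setDP[e'R _]|/imsetP[m' m'J Ee']].
    by rewrite -(joins_conn_comp _ e'R ej).
  rewrite Ee' in ej; case: (joins_inj (eej m'J) ej) => [[Ex _]|[_ Ex]].
    by move: (uuRm m'J mJ); rewrite Ex mx.
  rewrite -Ex in mx; have /val_inj Em := sep (ltn_ord m) (ltn_ord m') mx (conn_refl _ _ _).
  by case/eqP: ne; rewrite Ee' -Ee Em.
Qed.

(** The edges of [X] enter components after [t], so the arrow is not among them. If it has colour
    [c], it separates [u] from [r] in [T0], and by [acyc_bridge] also in the forest enlarged by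
    [G]. *)
Lemma swap_arc m' u j : 0 < j <= t -> m' < j -> conn R (w m') u ->
  conn T0 u r -> arrow ends col r u (w j) -> arrow ends col2 r u (w j).
Proof.
move=> /andP[j0 jt] m'j m'u ur [c' [e /and3P[eB ej nur]]]; exists c', e.
have eX : e \notin X.
  apply/negP=> /imsetP[m mJ Ee]; rewrite Ee in ej; have tm := Jt mJ.
  have jn : j < n by apply: leq_ltn_trans tn.
  case: (joins_inj (eej mJ) ej) => [[_ Ew]|[_ Ew]].
    have := sep jn (ltn_ord m) (conn_refl _ _ _); rewrite Ew conn_refl => /(_ isT) Ej.
    by move: jt tm; rewrite Ej; nlia.
  rewrite -Ew in m'u; have m'n := ltn_trans m'j jn.
  have := sep m'n (ltn_ord m) m'u (conn_refl _ _ _) => Em.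
  by move: tm jt m'j; rewrite Em; nlia.
have [Ec|nc] := eqVneq c' c; last first.
  by rewrite /arc_via blue_recolor_neq // eB ej.
rewrite {c'}Ec in eB nur *; rewrite /arc_via blue_recolor // ej /=.
have eT0 : e \in T0 by rewrite inE eX.
rewrite in_setU eT0 /=; apply: (acyc_bridge aT (subsetUl _ _) eT0 ur).
by apply: contra nur; apply: conn_mono; apply: setSD; apply: subsetDl.
Qed.

Lemma swap_card : #|red col2| + #|G| = #|R| + #|J|.
Proof. by rewrite card_recolor // cardX. Qed.

(** Tells whether [w t] is a terminal besides the tails. If so, [G] will have as many edges as [X];
    otherwise it will have one fewer. *)
Variable wt : bool.
Let Z := (if wt then [set w t] else set0) :|: uu @: J.
Hypothesis wtZ : wt -> w t \notin uu @: J.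
Hypothesis inG : forall e x y z, e \in G -> jn e x y -> z \in Z -> conn R z x.
Hypothesis pieces : forall z v, z \in Z -> conn R z v ->
  exists2 z', z' \in Z & conn (R :\: G) z' v.
Hypothesis sepZ : {in Z &, forall z z', conn (R :\: G) z z' -> z = z'}.

Let uuZ m : m \in J -> uu m \in Z.
Proof. by move=> mJ; rewrite inE imset_f // orbT. Qed.

Let ZR z : z \in Z -> conn R (w t) z.
Proof.
case/setUP=> [|/imsetP[m mJ ->]]; last exact: uuR.
by case: wt => [/set1P->|]; rewrite ?inE // conn_refl.
Qed.

Lemma swap_agree j e x y : j < t -> jn e x y -> conn R (w j) x -> (e \in R) = (e \in red col2).
Proof.
move=> jt ej jx; have jn := ltn_trans jt tn.
have eG : e \notin G.
  apply/negP=> eG; case/card_gt0P: J0 => m mJ.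
  have tx := conn_trans (uuR mJ) (inG eG ej (uuZ mJ)).
  by move: jt; rewrite (sep jn tn jx tx) ltnn.
have eX : e \notin X.
  apply/negP=> /imsetP[m mJ Ee]; rewrite Ee in ej.
  case: (joins_inj (eej mJ) ej) => [[Ex _]|[_ Ex]]; rewrite -Ex in jx.
    by move: jt; rewrite (sep jn tn jx (uuR mJ)) ltnn.
  have := sep jn (ltn_ord m) jx (conn_refl _ _ _) => Ej.
  by move: jt (Jt mJ); rewrite Ej; nlia.
by rewrite R2 in_setU (negPf eX) orbF in_setD eG.
Qed.

Let pz v := odflt v [pick z in Z | conn (R :\: G) z v].

Let pzP v : conn R (w t) v -> pz v \in Z /\ conn (R :\: G) (pz v) v.
Proof.
move=> tv; rewrite /pz; case: pickP => [z /andP[] //|none].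
case/card_gt0P: J0 => m mJ.
have [|z zZ zv] := pieces (uuZ mJ) (v := v).
  by apply: conn_trans tv; rewrite conn_sym uuR.
by have := none z; rewrite /= zZ zv.
Qed.

Let pz_uniq v z : z \in Z -> conn (R :\: G) z v -> pz v = z.
Proof.
move=> zZ zv; have tv : conn R (w t) v by apply: conn_trans (ZR zZ) (conn_subD zv).
have [pZ pv] := pzP tv; apply: sepZ => //; apply: conn_trans pv _; by rewrite conn_sym.
Qed.

(** The labelling for [total_excess_relabel]: a piece is labelled by its terminal, a child by the
    tail on which it now hangs, and every other component as before. *)
Let lab v := if conn R (w t) v then pz v
  else if [pick m in J | conn R (w m) v] is Some m then uu m else rep ends R v.

Let lab_child m v : m \in J -> conn R (w m) v -> lab v = uu m.
Proof.
move=> mJ mv; rewrite /lab; case: ifP => [tv|_].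
  by move: (Jt mJ); rewrite (sep tn (ltn_ord m) tv mv) ltnn.
case: pickP => [m' /andP[m'J m'v]|/(_ m)]; last by rewrite mJ mv.
by congr uu; apply/val_inj; apply: sep m'v mv.
Qed.

Let lab_conn x y : conn (red col2) x y -> lab x = lab y.
Proof.
move=> xy; suff : lab x == lab y by move/eqP.
apply: (conn_closed (Y := fun v => lab x == lab v) _ xy) => // e u v eR2 ej /eqP->.
move: eR2; rewrite R2 => /setUP[eRG|/imsetP[m mJ Ee]].
  have /setDP[eR eG] := eRG.
  rewrite /lab -(joins_conn_comp _ eR ej); case: ifP => [tu|_].
    have [pZ pu] := pzP tu; rewrite (pz_uniq (v := v) pZ) ?eqxx //.
    exact: conn_trans pu (conn_join eRG ej).
  have -> : [pick m in J | conn R (w m) u] = [pick m in J | conn R (w m) v].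
    by apply: eq_pick => m; rewrite /= (joins_conn_comp _ eR ej).
  by case: pickP => // _; rewrite rep_eq (conn_join eR ej).
have Eu : lab (uu m) = uu m by rewrite /lab uuR // (pz_uniq (z := uu m)) ?uuZ.
have Ew : lab (w m) = uu m by apply: lab_child => //; apply: conn_refl.
rewrite Ee in ej.
by case: (joins_inj (eej mJ) ej) => [[<- <-]|[<- <-]]; rewrite Eu Ew.
Qed.

Let fiber_sub z v : conn R (w t) z -> lab v = z -> z \in Z /\
  (conn (R :\: G) z v \/ exists2 m, m \in J & z = uu m /\ conn R (w m) v).
Proof.
move=> tz; rewrite /lab; case: ifP => [tv Ez|ntv].
  by have [] := pzP tv; rewrite Ez; split=> //; left.
case: pickP => [m /andP[mJ mv] Ez|_ Ez]; first by rewrite -Ez uuZ //; split=> //; right; exists m.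
by move: ntv; rewrite (conn_trans tz) // -Ez conn_sym conn_rep.
Qed.

Let piece z := component (R :\: G) z.

Let sum_pieces : \sum_(z in Z) #|piece z| <= #|component R (w t)|.
Proof.
apply: sum_card_disjoint => [z zZ|z z' zZ z'Z u].
  by apply/subsetP=> u; rewrite !inE => zu; apply: conn_trans (ZR zZ) (conn_subD zu).
rewrite !inE => zu z'u; apply: sepZ => //; apply: conn_trans zu _; by rewrite conn_sym.
Qed.

Let big_uu (P : V -> nat) : \sum_(z in uu @: J) P z = \sum_(m in J) P (uu m).
Proof. exact: big_imset. Qed.

Let big_Z (P : V -> nat) :
  \sum_(z in Z) P z = (if wt then P (w t) else 0) + \sum_(m in J) P (uu m).
Proof.
rewrite -big_uu /Z; case: (boolP wt) => [/wtZ nZ|_]; last by rewrite set0U add0n.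
by rewrite big_setU1.
Qed.

(** As the tails are distinct, each fiber of [lab] at a terminal lies in one piece together with at
    most one child; [numeric] then compares these sizes with the old component. *)
Lemma swap_excess : total_excess (red col2) <= total_excess R.
Proof.
have le : total_excess (red col2) + excess #|component R (w t)| <=
    total_excess R + \sum_(v in component R (w t)) excess #|fiber lab v|.
  apply: total_excess_relabel => [x y|v]; first exact: lab_conn.
  rewrite inE /lab; case: ifP => [tv|_].
    by rewrite ZR //; case: (pzP tv).
  by case: pickP => // m /andP[mJ _]; rewrite uuR.
suff : \sum_(v in component R (w t)) excess #|fiber lab v| <= excess #|component R (w t)|.
  by move: le; nlia.
have -> : \sum_(v in component R (w t)) excess #|fiber lab v| =
    \sum_(z in Z) excess #|fiber lab z|.
  rewrite (big_setID Z) /= [X in _ + X]big1 ?addn0 => [|z /setDP[tz nZ]]; last first.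
    suff -> : fiber lab z = set0 by rewrite cards0.
    apply/setP=> v; rewrite !inE; apply/negP=> /eqP Ev.
    by rewrite inE in tz; case: (fiber_sub tz Ev) => zZ; rewrite zZ in nZ.
  by apply: eq_bigl => z; rewrite in_setI andb_idl // => zZ; rewrite inE ZR.
apply: (@leq_trans (\sum_(z in Z) excess (#|piece z| +
    (if [pick m in J | z == uu m] is Some m then #|component R (w m)| else 0)))).
  apply: leq_sum => z zZ; apply: excess_mono.
  case: pickP => [m /andP[mJ /eqP Ez]|none].
    apply: (@leq_trans #|piece z :|: component R (w m)|); last first.
      by rewrite cardsU leq_subr.
    apply: subset_leq_card; apply/subsetP=> v; rewrite !inE => /eqP Ev.
    case: (fiber_sub (ZR zZ) Ev) => _ [->//|[m' m'J [Ez' m'v]]].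
    rewrite Ez in Ez'; rewrite (uu_inj mJ m'J Ez') m'v; exact: orbT.
  rewrite addn0; apply: subset_leq_card; apply/subsetP=> v; rewrite !inE => /eqP Ev.
  case: (fiber_sub (ZR zZ) Ev) => _ [->//|[m' m'J [Ez' m'v]]].
  by have := none m'; rewrite m'J Ez' eqxx.
rewrite big_Z.
have Em m : m \in J -> [pick m' in J | uu m == uu m'] = Some m.
  move=> mJ; case: pickP => [m' /andP[m'J /eqP/(uu_inj mJ m'J) ->] //|/(_ m)].
  by rewrite mJ eqxx.
under eq_bigr => m mJ do rewrite (Em m mJ).
have -> : (if wt then excess (#|piece (w t)| +
      (if [pick m in J | w t == uu m] is Some m then #|component R (w m)| else 0)) else 0) =
    excess (if wt then #|piece (w t)| else 0).
  case: (boolP wt) => // /wtZ nZ; case: pickP => [m /andP[mJ /eqP Ew]|]; last by rewrite addn0.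
  by rewrite Ew imset_f in nZ.
apply: (numeric (p := fun m => #|piece (uu m)|)); last first.
  by rewrite -(big_Z (fun z => #|piece z|)); apply: sum_pieces.
by move=> m mJ; apply/card_gt0P; exists (uu m); rewrite inE conn_refl.
Qed.

Lemma swap_piece_wt : wt -> #|component (red col2) (w t)| < #|component R (w t)|.
Proof.
move=> hwt; have wZ : w t \in Z by rewrite /Z hwt !inE eqxx.
have lw : lab (w t) = w t by rewrite /lab conn_refl; apply: pz_uniq.
case/card_gt0P: J0 => m mJ; apply: proper_card; apply/properP.
have sub v : conn (red col2) (w t) v -> conn (R :\: G) (w t) v.
  move=> /lab_conn; rewrite lw => /esym Ev.
  case: (fiber_sub (conn_refl _ _ _) Ev) => _ [//|[m' m'J [Ew _]]].
  by have := wtZ hwt; rewrite Ew imset_f.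
split; first by apply/subsetP=> v; rewrite !inE => /sub/conn_subD.
exists (uu m); rewrite inE ?uuR //; apply/negP=> /sub /sepZ => /(_ wZ (uuZ mJ)) Ew.
by have := wtZ hwt; rewrite Ew imset_f.
Qed.

End Pieces.

(** Let [L] be the first component with a vertex cut off from the root in [T0]. If [L = t] and [w t]
    itself is not cut off, then [w t] is made a terminal: the number of red edges is unchanged and
    the component of [w t] shrinks. Otherwise a vertex [tau] of component [L] is kept cut off, which
    costs one extra red edge, and an augmentation starting from [tau] removes a red edge from a
    component before [t]. This lowers the total excess if that component is the first one, and the
    code if not. *)
Lemma swap_impossible : False.
Proof.
pose P j := [exists v, conn R (w j) v && ~~ conn T0 v r].
have Pt : P t.
  by case/card_gt0P: J0 => m mJ; apply/existsP; exists (uu m); rewrite uuR // uu_cut.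
case: (ex_minnP (ex_intro _ t Pt)) => L PL minL; have Lt := minL t Pt.
have below j u : j < L -> conn R (w j) u -> conn T0 u r.
  move=> jL ju; apply/negPn/negP=> nu.
  by have /minL : P j; [apply/existsP; exists u; rewrite ju | rewrite leqNgt jL].
have tcover v : conn R (w t) v -> conn T0 v r \/ exists2 m, m \in J & conn T0 v (uu m).
  by move=> tv; apply/cover/(blue_conn _ tn tv).
have tconn x y : conn R (w t) x -> conn R (w t) y -> conn R x y.
  by move=> tx; apply: conn_trans; rewrite conn_sym.
have t0 : 0 < t by case/andP: ht.
have [/andP[/eqP EL wtr]|caseA] := boolP ((L == t) && conn T0 (w t) r).
  pose Z := [set w t] :|: uu @: J.
  have wtZ : w t \notin uu @: J.
    by apply/negP=> /imsetP[m mJ Ew]; move: (uu_cut mJ); rewrite -Ew wtr.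
  have ZR z : z \in Z -> conn R (w t) z.
    by case/setU1P=> [->|/imsetP[m mJ ->]]; [apply: conn_refl | apply: uuR].
  have [||||G [[sG cG] inG pieces sepZ ind]] :=
    @split_terminals _ _ ends R (conn T0) Z aR (conn_equivalence _ _).
  - by rewrite cardsU1 wtZ.
  - by move=> z z' /ZR tz /ZR tz'; apply: tconn.
  - move=> z z' /setU1P[->|/imsetP[m mJ ->]] /setU1P[->|/imsetP[m' m'J ->]] // h.
    + by move: (uu_cut m'J); rewrite conn_sym in h; rewrite (conn_trans h).
    + by move: (uu_cut mJ); rewrite (conn_trans h).
    + by rewrite (uu_sep mJ m'J h).
  - move=> z v /ZR tz zv; case: (tcover v (conn_trans tz zv)) => [vr|[m mJ vm]].
      exists (w t); first by rewrite setU11.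
      by apply: conn_trans vr _; rewrite conn_sym.
    by exists (uu m) => //; rewrite in_setU imset_f ?orbT.
  have [|aT _] := ind T0 _ (fun x y h => h).
    by apply: acyc_sub (@aB c); apply: subsetDl.
  pose col2 := recolor col c X G.
  have cardZ : #|G| = #|J|.
    by move: cG; rewrite cardsU1 wtZ (card_in_imset uu_inj) add1n => -[].
  apply: (@prefix_optimal col2 t ht).
  - split.
    + by split; [apply: swap_blue_acyc|apply: (@swap_red_acyc G)].
    + by have := swap_card sG; rewrite cardZ => /addIn->.
    + exact: (@swap_excess G true).
  - by move=> j e x y; apply: (@swap_agree G true).
  - move=> j jt; case/andP: (jt) => j0 j_t.
    have [|[m' [u [m'j m'u ar]]] _] := leg (j := j); first by rewrite j0 (leq_ltn_trans j_t).
    exists m', u; split=> //; apply: (swap_arc sG aT jt m'j m'u _ ar).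
    by apply: (below m') => //; rewrite EL (leq_trans m'j).
  - exact: (@swap_piece_wt G true).
(* For [L = t] the choice [tau = w t] triggers the strict alternative of [augment], so that the
   augmented component precedes [t]. *)
have [tau [Ltau ntau tauw]] : exists tau,
    [/\ conn R (w L) tau, ~~ conn T0 tau r & L = t -> tau = w t].
  have [EL|nL] := eqVneq L t.
    by exists (w t); rewrite EL conn_refl; split=> //; move: caseA; rewrite EL eqxx.
  by case/existsP: PL => v /andP[Lv nv]; exists v; split=> // EL; rewrite EL eqxx in nL.
pose Z := set0 :|: uu @: J.
have ZR z : z \in Z -> conn R (w t) z.
  by rewrite /Z set0U => /imsetP[m mJ ->]; apply: uuR.
have Ln : L < n by apply: leq_ltn_trans tn.
have [tr|[m0 m0J taum]] := cover (blue_conn c Ln Ltau).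
  by rewrite tr in ntau.
(* Merging the classes of [r] and [tau] in advance prevents [G] from reconnecting them. *)
have [||||G [[sG cG] inG pieces sepZ ind]] :=
  @split_terminals _ _ ends R (link (conn T0) r tau) Z aR
    (link_equivalence _ _ (conn_equivalence _ _)).
- by rewrite /Z set0U (card_in_imset uu_inj).
- by move=> z z' /ZR tz /ZR tz'; apply: tconn.
- move=> z z'; rewrite /Z set0U => /imsetP[m mJ ->] /imsetP[m' m'J ->].
  case/or3P=> [h|/andP[h _]|/andP[_ h]].
  + by rewrite (uu_sep mJ m'J h).
  + by move: (uu_cut mJ); rewrite h.
  + by move: (uu_cut m'J); rewrite conn_sym h.
- move=> z v /ZR tz zv; case: (tcover v (conn_trans tz zv)) => [vr|[m mJ vm]].
    exists (uu m0); first by rewrite /Z set0U imset_f.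
    by rewrite /link vr taum orbT.
  by exists (uu m); rewrite /Z ?set0U ?imset_f // /link vm.
have [||aT nT] := ind T0.
- by apply: acyc_sub (@aB c); apply: subsetDl.
- by move=> x y h; rewrite /link h.
have cardG : #|G|.+1 = #|J| by rewrite cG /Z set0U (card_in_imset uu_inj).
pose col2 := recolor col c X G.
have agree2 := @swap_agree G false inG.
have same j v : j < t -> conn (red col2) (w j) v = conn R (w j) v.
  by move=> jt; apply: conn_agree => e x y; apply: agree2.
have aB2 : blue_acyc col2 by apply: swap_blue_acyc.
have aR2 : acyc (red col2) by apply: swap_red_acyc.
have exc2 : total_excess (red col2) <= total_excess R by apply: (@swap_excess G false).
have leg2 : legal col2 w L.+1.
  move=> j /andP[j0 jL]; rewrite ltnS in jL; have jt := leq_trans jL Lt.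
  have [|[m' [u [m'j m'u ar]]] sepj] := leg (j := j); first by rewrite j0 (leq_ltn_trans jt).
  split.
    exists m', u; split=> //; first by rewrite same // (leq_trans m'j).
    apply: (swap_arc sG aT _ m'j m'u _ ar); first by rewrite j0.
    by apply: (below m') => //; apply: leq_trans jL.
  by move=> m mj; rewrite same ?sepj // (leq_trans mj).
have nTr : ~~ conn (blue col2 c) tau r.
  rewrite blue_recolor //; apply: nT; first by rewrite /link !conn_refl !orbT.
  exact: ntau.
have [|l [f [a [b [col3 [[lL lL'] [fR fj] lb [aB3 R3] arcs]]]]]] :=
  augment aB2 leg2 (@comp_closed _ _ ends _ tau) nTr.
  exists tau; rewrite conn_refl; split=> //.
  have [EL|nL] := eqVneq L t; last by rewrite same // ltn_neqAle nL.
  by rewrite (tauw EL) EL conn_refl.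
have lt : l < t.
  have [EL|nL] := eqVneq L t; last by apply: leq_ltn_trans lL _; rewrite ltn_neqAle nL.
  by rewrite -EL; apply: lL'; rewrite (tauw EL) EL conn_refl.
have lnn := ltn_trans lt tn.
have lb' : conn R (w l) b by rewrite -same // (conn_subD lb).
have la2 : conn (red col2) (w l) a by apply: conn_trans (conn_subD lb) (conn_join fR fj).
have la : conn R (w l) a by rewrite -same.
have nba := aR2 f b a fR fj.
have smaller : #|component (red col3) (w l)| < #|component R (w l)|.
  apply: proper_card; apply/properP; split.
    by apply/subsetP=> v; rewrite !inE R3 => /conn_subD; rewrite same.
  exists a; rewrite inE // R3; apply: contra nba; apply: conn_trans.
  by rewrite conn_sym.
have val3 : valid col3.
  by split=> //; rewrite R3; apply: acyc_sub aR2; apply: subsetDl.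
have card3 : #|red col3| <= #|R|.
  have := swap_card sG; rewrite -cardG R3 -/col2 (cardsD1 f (red col2)) fR; nlia.
have exc3 : total_excess (red col3) <= total_excess R.
  by apply: leq_trans exc2; rewrite R3; apply: total_excess_sub; apply: subsetDl.
(* The first component is oversized, so losing an edge there lowers the total excess. *)
case: (posnP l) => [El|l0].
  case: min => _ [_ _ _ big] _ minE _; have := minE _ val3 card3.
  apply/negP; rewrite -ltnNge; apply: leq_trans exc2; rewrite R3.
  apply: (total_excess_cut fR fj nba).
  suff -> : component (red col2) b = component R r by [].
  apply/setP=> v; rewrite !inE; rewrite El in lb; rewrite -same //.
  by apply/idP/idP=> h; [apply: conn_trans (conn_subD lb) h
    | apply: conn_trans h; rewrite conn_sym (conn_subD lb)].
apply: (@prefix_optimal col3 l) => //; first by rewrite l0.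
  move=> j e x y jl ej jx; have jt := ltn_trans jl lt.
  rewrite (agree2 j e x y) // R3 in_setD1; case: eqP => //= Ee.
  rewrite Ee in ej; have lx : conn R (w l) x.
    by case: (joins_inj fj ej) => [[<-]|[_ <-]].
  by move: jl; rewrite (sep (ltn_trans jt tn) lnn jx lx) ltnn.
move=> j jl; have [m [u [mj mu ar]]] := arcs j jl; exists m, u; split=> //.
by rewrite -same //; apply: ltn_trans mj _; apply: leq_ltn_trans lt; case/andP: jl.
Qed.

End Swap.

(** An arrow to a new component would extend the exploration and replace the filler digit at
    position [n] by a smaller one. *)
Lemma minimal_closed : closed_exploration ends col w n.
Proof.
move=> j u y jlt ju a; apply/existsP; apply: contraT.
rewrite negb_exists => /forallP new; exfalso.
have n0 : 0 < n by apply: leq_ltn_trans jlt.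
have nw : no_worse col col by [].
case: min => _ [_ _ cen big] _ _ /(_ col (extend w n y) n.+1 nw) minc.
suff cfg : config col (extend w n y) n.+1.
  move: (minc cfg); apply/negP; rewrite -ltnNge /code.
  apply: (@lex_code_lt _ _ _ _ n).
  - by rewrite ltnS (legal_length leg).
  - by move=> i; case: ifP => // _; rewrite ltnS; apply/leqW/component_le.
  - by move=> i ilt; rewrite ilt (leqW ilt) extend_lt.
  - by rewrite ltnSn ltnn ltnS component_le.
split=> //; rewrite ?extend_lt //.
by apply: (legal_extend leg jlt ju a) => i ilt; apply: (new (Ordinal ilt)).
Qed.

(** Otherwise exchange [e] for an edge [g] of the red path from [r] to [u] that reconnects the two
    sides of [e] in the forest [c]. By centrality more than [N] vertices stay with [r], whereas the
    other side gains at most [N], so the total excess drops. *)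
Lemma root_child m c e u : 0 < m < n -> N <= D -> conn R r u ->
  arc_via col r c e u (w m) -> N < #|component R (w m)|.
Proof.
move=> /andP[m0 mn] ND ru /and3P[eB ej nur]; rewrite ltnNge; apply/negP=> small.
have n0 : 0 < n by apply: leq_ltn_trans mn.
have [||g [p [q [[gR gj] rp nrq rp' qu]]]] :=
  conn_exit (B := fun v => conn (blue col c :\ e) v r) ru.
- exact: conn_refl.
- exact: nur.
have npq := aR gR gj.
have nru : ~~ conn (R :\ g) r u.
  apply: contra npq => h; rewrite conn_sym; apply: conn_trans qu _.
  by apply: conn_trans rp'; rewrite conn_sym.
have sX : [set e] \subset blue col c by rewrite sub1set.
have sG : [set g] \subset R by rewrite sub1set.
pose col2 := recolor col c [set e] [set g].
have R2 : red col2 = e |: (R :\ g) by rewrite red_recolor setUC.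
have mru : ~~ conn R (w m) u.
  by apply/negP=> h; move: m0; rewrite -(sep n0 mn ru h).
have val2 : valid col2.
  split=> [c'|].
    have [->|nc] := eqVneq c' c; last by rewrite blue_recolor_neq.
    rewrite blue_recolor // setUC; apply: acyc_add gj _.
      by apply: acyc_sub (@aB c); apply: subsetDl.
    by apply: contra nrq => h; apply: conn_trans rp; rewrite conn_sym.
  rewrite R2; apply: (acyc_add_cut (Y := conn R (w m)) (p := w m) (q := u)) => //.
  - by apply: acyc_sub aR; apply: subsetDl.
  - by rewrite joinsC.
  - by move=> e' x y /setD1P[_ e'R] e'j; rewrite -(joins_conn_comp _ e'R e'j).
have card2 : #|red col2| <= #|R|.
  by have := card_recolor sX sG; rewrite !cards1 => /addIn->.
case: min => _ [_ _ cen big] _ minE _; have := minE _ val2 card2.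
apply/negP; rewrite -ltnNge.
pose lab v := if conn R r v then if conn (R :\ g) r v then r else u
  else if conn R (w m) v then u else rep ends R v.
have labu : lab u = u by rewrite /lab ru (negPf nru).
have nrw : ~~ conn R r (w m) by apply: sep_lt.
have labw : lab (w m) = u by rewrite /lab (negPf nrw) conn_refl.
have labin v : conn R r v -> conn R r (lab v).
  by move=> rv; rewrite /lab rv; case: ifP => // _; apply: conn_refl.
have le : total_excess (red col2) + excess #|component R r| <=
    total_excess R + \sum_(v in component R r) excess #|fiber lab v|.
  apply: total_excess_relabel => [x y xy|v]; last first.
    rewrite inE => nv; have rv : ~~ conn R r v by apply: contra nv; apply: labin.
    move: nv; rewrite /lab (negPf rv); case: ifP => //; by rewrite ru.
  suff : lab x == lab y by move/eqP.
  apply: (conn_closed (Y := fun v => lab x == lab v) _ xy) => // e' a b.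
  rewrite R2 => /setU1P[Ee|e'Rg] e'j /eqP->.
    rewrite Ee in e'j.
    by case: (joins_inj ej e'j) => [[<- <-]|[<- <-]]; rewrite labu labw.
  have /setD1P[_ e'R] := e'Rg.
  rewrite /lab -!(joins_conn_comp _ e'R e'j) -(joins_conn_comp _ e'Rg e'j).
  by do 2!case: ifP => // _; rewrite rep_eq (conn_join e'R e'j).
suff : \sum_(v in component R r) excess #|fiber lab v| < excess #|component R r|.
  by move: le; nlia.
have nur' : u != r by apply: contraNneq nru => ->; apply: conn_refl.
rewrite (bigD1 r) ?inE ?conn_refl //= (bigD1 u) ?inE ?ru //= big1 ?addn0; last first.
  move=> v /andP[/andP[rv nr] nu]; suff -> : fiber lab v = set0 by rewrite cards0.
  apply/setP=> x; rewrite !inE; apply/negbTE/negP=> /eqP Ev.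
  rewrite inE in rv; move: nr nu rv; rewrite -Ev /lab; case: ifP => [rx|nrx].
    by case: ifP; rewrite eqxx.
  case: ifP => [_|_ _ _ h]; first by rewrite eqxx.
  by move: nrx; rewrite (conn_trans h) // conn_sym conn_rep.
have subr : fiber lab r \subset component (R :\ g) r.
  apply/subsetP=> v; rewrite !inE /lab; case: ifP => [rv|nrv].
    by case: ifP => // _; rewrite (negPf nur').
  case: ifP; rewrite ?(negPf nur') // => _ /eqP Er.
  by move: nrv; rewrite conn_sym -Er conn_rep.
have subu : fiber lab u \subset (component R r :\: component (R :\ g) r) :|: component R (w m).
  apply/subsetP=> v; rewrite !inE /lab; case: ifP => [rv|nrv].
    by case: ifP => //; rewrite eq_sym (negPf nur').
  case: ifP => [|_ /eqP Eu]; first by rewrite orbT.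
  by move: nrv; rewrite (conn_trans ru) // -Eu conn_sym conn_rep.
have cK : #|component (R :\ g) r| + #|component R r :\: component (R :\ g) r| = #|component R r|.
  rewrite -(cardsID (component (R :\ g) r) (component R r)); congr (_ + _).
  by apply: eq_card => v; rewrite !inE andb_idl // => /conn_subD.
have kx : 0 < #|component R r :\: component (R :\ g) r|.
  by apply/card_gt0P; exists u; rewrite !inE ru nru.
have cen' := cen g.
apply: (@leq_ltn_trans (excess #|component (R :\ g) r| +
  excess (#|component R r :\: component (R :\ g) r| + #|component R (w m)|))).
  apply: leq_add; apply: excess_mono; first exact: subset_leq_card.
  apply: leq_trans (subset_leq_card subu) _; by rewrite cardsU leq_subr.
move: big cen' kx cK small ND; rewrite /excess.
move: #|component R r| #|component (R :\ g) r| #|_ :\: _| #|component R (w m)|.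
by clear; lia.
Qed.

End MinimalConfiguration.

Lemma exists_min (A : Type) (P : A -> Prop) (f : A -> nat) :
  (exists x, P x) -> exists x, P x /\ forall y, P y -> f x <= f y.
Proof.
case=> x0 Px0; have [m] := ubnP (f x0); elim: m x0 Px0 => // m IHm x Px ltm.
have [[y [Py lty]]|none] := classic (exists y, P y /\ f y < f x).
  by apply: (IHm y Py); apply: leq_trans lty _.
exists x; split=> // y Py; rewrite leqNgt; apply/negP=> lty.
by apply: none; exists y.
Qed.

(** * Edge counts in the explored set and the initial forest partition *)

Section Counting.
Variables (V E : finType) (ends : E -> V * V).
Local Notation jn := (joins ends).
Local Notation conn := (conn ends).
Local Notation component := (component ends).
Local Notation acyc := (acyc ends).

Definition inside (S : {set V}) : {set E} :=
  [set e | ((ends e).1 \in S) && ((ends e).2 \in S)].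

Lemma inside_joins S e x y : jn e x y -> (e \in inside S) = (x \in S) && (y \in S).
Proof.
by rewrite inE => /orP[] /andP[/eqP <- /eqP <-] //; rewrite andbC.
Qed.

(** Each vertex of [A] is sent to its out-edge. This is injective, since no edge can separate both
    of its ends from their common root. *)
Lemma card_le_out_edges (F : {set E}) (A : {set V}) (Q : {set E}) (rt : V -> V) :
    acyc F -> {in A, forall v, conn F v (rt v) /\ v != rt v} ->
    {in A &, forall u v, conn F u v -> rt u = rt v} ->
    (forall v e y, v \in A -> e \in F -> jn e v y -> ~~ conn (F :\ e) v (rt v) -> e \in Q) ->
  #|A| <= #|F :&: Q|.
Proof.
move=> aF Art rtE AQ.
pose out v := [pick e in F | [exists y, jn e v y] && ~~ conn (F :\ e) v (rt v)].
have outP v : v \in A -> exists e y,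
    [/\ out v = Some e, e \in F :&: Q, jn e v y & ~~ conn (F :\ e) v (rt v)].
  move=> vA; rewrite /out; case: pickP => [e /and3P[eF /existsP[y ej] ne]|none].
    by exists e, y; rewrite inE eF (AQ v e y).
  have [vr nvr] := Art v vA; have [e [y [eF ej ne]]] := out_edge_exists aF vr nvr.
  by move: (none e); rewrite eF ne andbT /= => /existsP[]; exists y.
have someI : injective (@Some E) by move=> ? ? [].
rewrite -(card_imset _ someI) -(card_in_imset (f := out) (D := A)).
  apply: subset_leq_card; apply/subsetP=> o /imsetP[v /outP[e [y [-> eFQ _ _]]] ->].
  exact: imset_f.
move=> u v uA vA; have [e [y [-> eF ej ne]]] := outP u uA.
have [e' [y' [-> _ ej' ne']]] := outP v vA => -[Ee]; rewrite -Ee in ej' ne'.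
case: (joins_inj ej ej') => [[//]|[Eu Ey]].
rewrite -{y'}Eu in ej'; rewrite Ey in ej.
have /setIP[eF' _] := eF.
have uv := conn_join eF' ej; rewrite -(rtE u v uA vA uv) in ne'.
have [ur _] := Art u uA.
by case: (conn_del eF' ej ur) => [|[]|[]]; rewrite ?(negPf ne) ?(negPf ne').
Qed.

(** The remaining edges of a cycle connect the ends of its first edge. *)
Lemma acyc_forest F : acyc F -> is_forest ends F.
Proof.
move=> aF [[|[|m]] [es [vs [//_ es_inj vs_inj esF esj]]]].
pose o j : 'I_m.+2 := inord j.
have oS j : j < m.+1 -> ordS (o j) = o j.+1.
  move=> jm; apply: val_inj; rewrite /= !inordK ?modn_small //.
  by apply: ltnW.
have ne j : 0 < j < m.+2 -> es (o j) \in F :\ es (o 0).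
  move=> /andP[j0 jm]; rewrite !inE esF andbT; apply/negP=> /eqP/es_inj.
  by move/(congr1 val); rewrite /= !inordK // => Ej; rewrite Ej in j0.
have walk j : j < m.+1 -> conn (F :\ es (o 0)) (vs (o 1)) (vs (o j.+1)).
  elim: j => [|j IHj] jm; first exact: conn_refl.
  apply: conn_trans (IHj (ltnW jm)) _; apply: (@conn_join _ _ _ _ (es (o j.+1))).
    by apply: ne; rewrite /= ltnS ltnW.
  by rewrite -[o j.+2]oS.
have j0 := esj (o 0); rewrite oS // in j0.
move/negP: (aF _ _ _ (esF _) j0); apply; rewrite conn_sym.
apply: conn_trans (walk m (ltnSn m)) _; apply: (@conn_join _ _ _ _ (es (o m.+1))).
  by apply: ne; rewrite /= ltnSn.
have <- : ordS (o m.+1) = o 0 by apply: val_inj; rewrite /= !inordK // modnn.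
exact: esj.
Qed.

(** Each edge is sent to its end farther from [v]. By [out_edges_separate] this is injective, and
    [v] itself is never hit. *)
Lemma card_comp_edges F v : acyc F -> #|comp_edges ends F v| <= #|component F v|.-1.
Proof.
move=> aF; pose far e := if conn (F :\ e) v (ends e).1 then (ends e).2 else (ends e).1.
have farP e : e \in comp_edges ends F v -> exists y,
    [/\ e \in F, jn e (far e) y, ~~ conn (F :\ e) (far e) v & conn F (far e) v].
  rewrite inE => /andP[eF v1]; have ej := joins_ends ends e; rewrite /far.
  have v2 := conn_trans v1 (conn_join eF ej).
  case: ifP => [h|h]; last by exists (ends e).2; rewrite ![conn _ _ v]conn_sym h.
  exists (ends e).1; rewrite ![conn _ _ v]conn_sym joinsC; split=> //.
  by apply: contra (aF _ _ _ eF ej); apply: conn_trans; rewrite conn_sym.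
have far_inj : {in comp_edges ends F v &, injective far}.
  move=> e e' /farP[y [eF ej ne er]] /farP[y' [e'F ej' ne' er']] Ef.
  apply/eqP; apply: contraT => nee; rewrite -Ef in ej' ne' er'.
  by have := out_edges_separate aF er er' eF e'F ej ej' ne ne' nee; rewrite conn_refl.
rewrite -(card_in_imset far_inj) (cardsD1 v (component F v)) inE conn_refl /=.
apply: subset_leq_card; apply/subsetP=> x /imsetP[e /farP[y [_ _ ne er]] ->].
by rewrite !inE conn_sym er andbT; apply: contraNneq ne => ->; apply: conn_refl.
Qed.

Section Explored.
Variables (K : nat) (col : E -> option 'I_K) (w : nat -> V) (n : nat).
Hypotheses (aB : blue_acyc ends col) (unf : unfillable ends col).
Hypotheses (leg : legal ends col w n) (n0 : 0 < n) (cl : closed_exploration ends col w n).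
Local Notation R := (red col).

Definition explored : {set V} := [set v | [exists j : 'I_n, conn R (w j) v]].

Lemma card_explored : \sum_(j < n) #|component R (w j)| <= #|explored|.
Proof.
rewrite (eq_bigl (fun j => j \in [set: 'I_n])) => [|j]; last by rewrite inE.
apply: sum_card_disjoint => [j _|i j _ _ u].
  by apply/subsetP=> v; rewrite !inE => jv; apply/existsP; exists j.
by rewrite !inE => iu ju; apply/val_inj; apply: legal_sep leg _ _ iu ju.
Qed.

Lemma explored_root : w 0 \in explored.
Proof. by rewrite inE; apply/existsP; exists (Ordinal n0); apply: conn_refl. Qed.

(** Every explored vertex except the root has an out-edge in the forest [c], and closedness puts its
    head in the explored set. *)
Lemma card_blue_explored c : #|explored|.-1 <= #|blue col c :&: inside explored|.
Proof.
have -> : #|explored|.-1 = #|explored :\ w 0|.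
  by rewrite (cardsD1 (w 0) explored) explored_root.
apply: (card_le_out_edges (rt := fun=> w 0)) => //.
  move=> v /setD1P[nv]; rewrite inE => /existsP[j jv]; split=> //.
  exact: (explored_conn c aB unf leg (ltn_ord j) jv).
move=> v e y /setD1P[nv vS] eB ej out; rewrite (inside_joins _ ej) vS /=.
move: vS; rewrite !inE => /existsP[j jv].
have [|i iy] := cl (ltn_ord j) jv (y := y); last by apply/existsP; exists i.
by exists c, e; rewrite /arc_via eB ej.
Qed.

Lemma card_red_explored : acyc R -> #|explored| <= n + #|R :&: inside explored|.
Proof.
move=> aR; pose W := [set w j | j : 'I_n].
have cW : #|W| <= n by rewrite -[X in _ <= X]card_ord; apply: leq_imset_card.
apply: (@leq_trans (#|W| + #|explored :\: W|)).
  by rewrite -(cardsID W explored) leq_add2r subset_leq_card ?subsetIr.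
apply: leq_add => //.
pose rt v := if [pick j : 'I_n | conn R (w j) v] is Some j then w j else v.
have rtP (j : 'I_n) v : conn R (w j) v -> rt v = w j.
  move=> jv; rewrite /rt; case: pickP => [i iv|/(_ j)]; last by rewrite jv.
  by congr w; apply: legal_sep leg _ _ iv jv.
have inW (j : 'I_n) : w j \in W by apply/imsetP; exists j.
apply: (card_le_out_edges (rt := rt)) => //.
- move=> v /setDP[]; rewrite inE => /existsP[j jv] nW; rewrite (rtP j v jv) conn_sym.
  by split=> //; apply: contraNneq nW => ->.
- move=> u v /setDP[]; rewrite inE => /existsP[j ju] _ _ uv.
  by rewrite (rtP j u ju) (rtP j v (conn_trans ju uv)).
- move=> v e y /setDP[vS _] eR ej _; rewrite (inside_joins _ ej) vS /=.
  move: vS; rewrite !inE => /existsP[j jv]; apply/existsP; exists j.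
  by rewrite -(joins_conn_comp _ eR ej).
Qed.

Lemma card_inside_explored :
  K * #|explored|.-1 + #|R :&: inside explored| <= #|inside explored|.
Proof.
rewrite -(cardsID R (inside explored)) addnC setIC leq_add2l.
apply: (@leq_trans (\sum_(c < K) #|blue col c :&: inside explored|)).
  have -> : K * #|explored|.-1 = \sum_(c < K) #|explored|.-1.
    by rewrite sum_nat_const card_ord.
  by apply: leq_sum => c _; apply: card_blue_explored.
rewrite (eq_bigl (fun c => c \in [set: 'I_K])) => [|j]; last by rewrite inE.
apply: sum_card_disjoint => [c _|c c' _ _ e].
  by apply/subsetP=> e; rewrite !inE => /andP[/eqP->].
by rewrite !inE => /andP[/eqP-> _] /andP[/eqP[]].
Qed.

End Explored.

(** A longest legal exploration is closed; its length is bounded by [legal_length]. *)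
Lemma exploration_exists K (col : E -> option 'I_K) v : exists w n,
  [/\ legal ends col w n, 0 < n, w 0 = v & closed_exploration ends col w n].
Proof.
have [|[w n] [[/= leg n0 wv] maxn]] := @exists_min _
    (fun x : (nat -> V) * nat => [/\ legal ends col x.1 x.2, 0 < x.2 & x.1 0 = v])
    (fun x => #|V| - x.2).
  by exists (fun=> v, 1); split=> //= j; rewrite ltnS leqn0 andbC; case: eqP => // ->.
exists w, n; split=> // j u y jlt ju ar; apply/existsP; apply: contraT.
rewrite negb_exists => /forallP new.
have leg' : legal ends col (extend w n y) n.+1.
  by apply: (legal_extend leg jlt ju ar) => i ilt; apply: (new (Ordinal ilt)).
have := maxn (extend w n y, n.+1); rewrite /= extend_lt //.
by move=> /(_ (And3 leg' isT wv)); have := legal_length leg'; move: #|V|; clear; lia.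
Qed.

(** Minimise the number of red edges. If one is left, the set explored from one of its ends contains
    that edge and, in each of the [k] forests, a spanning tree, which is too many edges. *)
Lemma forest_partition k : (forall e, (ends e).1 != (ends e).2) ->
    (forall S : {set V}, 1 < #|S| -> #|inside S| <= k * #|S|.-1) ->
  exists col : E -> option 'I_k, blue_acyc ends col /\ red col = set0.
Proof.
move=> noloop dens.
have [|col [aB minR]] := @exists_min _ (@blue_acyc V E ends k) (fun col => #|red col|).
  exists (fun=> None) => c; have -> : blue (fun _ : E => None) c = set0.
    by apply/setP=> e; rewrite !inE.
  by move=> e x y; rewrite inE.
exists col; split=> //; have [//|[f fR]] := set_0Vmem (red col); exfalso.
have unf : unfillable ends col.
  move=> col' g gR aB' Er; have := minR _ aB'.
  by rewrite Er [X in X <= _](cardsD1 g) gR ltnn.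
have [w [n [leg n0 w0 cl]]] := exploration_exists col (ends f).1.
have fS : f \in inside (explored col w n).
  rewrite (inside_joins _ (joins_ends ends f)) -w0 explored_root //= inE.
  apply/existsP; exists (Ordinal n0); rewrite /= w0.
  exact: conn_join fR (joins_ends ends f).
have S1 : 1 < #|explored col w n|.
  move: fS; rewrite (inside_joins _ (joins_ends ends f)) => /andP[f1 f2].
  by apply/card_gt1P; exists (ends f).1, (ends f).2.
have := card_inside_explored aB unf leg n0 cl; have := dens _ S1.
have : 0 < #|red col :&: inside (explored col w n)|.
  by apply/card_gt0P; exists f; rewrite inE fR.
nlia.
Qed.

(** The last of [k.+1] forests becomes the red one. *)
Lemma valid_partition k : (forall e, (ends e).1 != (ends e).2) ->
    (forall S : {set V}, 1 < #|S| -> #|inside S| <= k.+1 * #|S|.-1) ->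
  exists col : E -> option 'I_k, valid ends col.
Proof.
move=> noloop /(forest_partition noloop)[col [aB red0]].
exists (fun e => obind (unlift ord_max) (col e)); split=> [c|].
  apply: acyc_sub (aB (lift ord_max c)); apply/subsetP=> e; rewrite !inE.
  case: (col e) => //= i; case: unliftP => [j ->|//].
  by move=> /eqP[->].
apply: acyc_sub (aB ord_max); apply/subsetP=> e; rewrite !inE.
have : e \notin red col by rewrite red0 inE.
rewrite inE; case: (col e) => //= i _; case: unliftP => // -> _; exact: eqxx.
Qed.

End Counting.

(** * Numerical inequalities on sizes of children *)

Lemma sum_sparse (I : finType) (M : {set I}) (h : I -> nat) (f : nat -> nat) s :
    {homo f : i j / i <= j >-> j <= i} -> {in M, forall m, h m <= s} ->
    (forall j, j <= s -> #|[set m in M | h m <= j]| <= j.+1) ->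
  \sum_(m in M) f (h m) + (s.+1 - #|M|) * f s <= \sum_(j < s.+1) f j.
Proof.
(* Listed by increasing [h] from position 0, the element at position [j] has [h] at least [j]. The
   padding term treats missing elements as if they had [h] equal to [s], which lets the induction on
   [s] go through. *)
move=> fmono; elim: s M => [|s IHs] M hM cM.
  rewrite big_ord1; have -> : \sum_(m in M) f (h m) = #|M| * f 0.
    rewrite -sum_nat_const; apply: eq_bigr => m /hM; by rewrite leqn0 => /eqP->.
  have M1 : #|M| <= 1.
    by have := cM 0 isT; congr (_ <= _); apply: eq_card => m; rewrite !inE andb_idr // => /hM.
  by rewrite -mulnDl subnKC // mul1n.
pose M' := [set m in M | h m <= s].
have M's : #|M'| <= s.+1 by apply: cM.
have split_card : #|M| = #|M'| + #|M :\: M'|.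
  rewrite -(cardsID M' M); congr (_ + _); apply: eq_card => m; rewrite !inE.
  by case: (m \in M).
have cM1 : #|M| <= s.+2.
  have := cM s.+1 (leqnn _); congr (_ <= _); apply: eq_card => m.
  by rewrite !inE andb_idr // => /hM.
have top : \sum_(m in M :\: M') f (h m) = #|M :\: M'| * f s.+1.
  rewrite -sum_nat_const; apply: eq_bigr => m; rewrite !inE => /andP[nM mM].
  by congr f; apply/eqP; rewrite eqn_leq hM //= ltnNge; move: nM; rewrite mM.
have bot : \sum_(m in M :&: M') f (h m) = \sum_(m in M') f (h m).
  by apply: eq_bigl => m; rewrite !inE; case: (m \in M).
have IH : \sum_(m in M') f (h m) + (s.+1 - #|M'|) * f s <= \sum_(j < s.+1) f j.
  apply: IHs => [m|j js]; first by rewrite inE => /andP[].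
  apply: leq_trans (cM j (leqW js)); apply: subset_leq_card; apply/subsetP=> m.
  by rewrite !inE => /andP[/andP[-> _] ->].
rewrite [X in _ <= X]big_ord_recr /= (big_setID M') /= top bot -addnA -mulnDl.
have -> : #|M :\: M'| + (s.+2 - #|M|) = (s.+1 - #|M'|).+1 by move: split_card; nlia.
rewrite mulSn [f s.+1 + _]addnC addnA leq_add2r; apply: leq_trans IH.
by rewrite leq_add2l leq_mul2l fmono ?orbT.
Qed.

(** Under the second alternative no term of the sum is positive. Under the first, fix an oversized
    [m0]: since [a m <= D], every other term is smaller than its [p m], and these [#|J|.-1] units
    pay for [a m0]. *)
Lemma excess_children (I : finType) (J : {set I}) (D N : nat) (a p : I -> nat) p0 :
    0 < #|J| ->
    ({in J, forall m, a m < #|J| /\ a m <= D} \/ {in J, forall m, N.-1 + a m <= D}) ->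
    {in J, forall m, 0 < p m} -> p0 + \sum_(m in J) p m <= N ->
  excess D p0 + \sum_(m in J) excess D (p m + a m) <= excess D N.
Proof.
move=> J0 small p_pos le.
have pN m : m \in J -> p m <= N.
  by move=> mJ; apply: leq_trans le; rewrite (bigD1 m) //= addnCA leq_addr.
have [/existsP[m0 /andP[m0J big]]|none] := boolP [exists m in J, 0 < excess D (p m + a m)]; last first.
  rewrite big1 ?addn0; first by apply: excess_mono; apply: leq_trans le; apply: leq_addr.
  move=> m mJ; apply/eqP; rewrite -leqn0 leqNgt; apply: contra none => h.
  by apply/existsP; exists m; rewrite mJ.
case: small => small; last first.
  by move: big (small m0 m0J) (pN m0 m0J); rewrite /excess; lia.
have others : \sum_(m in J | m != m0) excess D (p m + a m) + (#|J|).-1 <=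
    \sum_(m in J | m != m0) p m.
  have -> : (#|J|).-1 = \sum_(m in J | m != m0) 1.
    rewrite (cardsD1 m0) m0J /= -sum1_card; apply: eq_bigl => m.
    by rewrite !inE andbC.
  rewrite -big_split /=; apply: leq_sum => m /andP[mJ _].
  by move: (small m mJ) (p_pos m mJ) => [_]; rewrite /excess; lia.
rewrite (bigD1 m0) //= in le; rewrite (bigD1 m0) //=.
case: (small m0 m0J) => aJ aD.
move: le big others aJ aD.
set x := \sum_(m in J | _) excess D _; set y := \sum_(m in J | _) p _.
by rewrite /excess; clearbody x y; move: x y #|J| (p m0) (a m0); clear; lia.
Qed.

Lemma choice_in (I : finType) (A : Type) (J : {set I}) (P : I -> A -> Prop) :
    0 < #|J| -> {in J, forall m, exists x, P m x} ->
  exists f : I -> A, {in J, forall m, P m (f m)}.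
Proof.
case/card_gt0P=> m0 m0J ex; have [x0 _] := ex m0 m0J.
apply: (fin_all_exists (P := fun m x => m \in J -> P m x)) => m.
by have [mJ|mJ] := boolP (m \in J); [have [x Px] := ex m mJ; exists x | exists x0].
Qed.

(** * Discharging the deficits of small components *)

Section Main.
Variables (V E : finType) (ends : E -> V * V) (k d D : nat).
Hypotheses (d0 : 0 < d) (k0 : 0 < k).
Local Notation conn := (conn ends).
Local Notation component := (component ends).
Let s := d.-1 %/ k.+1.
Hypotheses (dD : d <= D)
  (bound : k * (\sum_(j < s.+1) (d - k.+1 * j)) + d <= k.+1 * D).

Let s_lt : k.+1 * s < d.
Proof. by have := leq_trunc_div d.-1 k.+1; rewrite -/s mulnC; nlia. Qed.

Let small_le e : k.+1 * e < d -> e <= s.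
Proof. by move=> h; rewrite leq_divRL // mulnC; nlia. Qed.

Let s_double : s.*2.+1 <= d.
Proof. by apply: leq_ltn_trans s_lt; rewrite -mul2n leq_mul2r ltnS k0 orbT. Qed.

Section Contradiction.
Variables (col : E -> option 'I_k) (w : nat -> V) (n : nat).
Hypothesis min : minimal ends D s.+1 col w n.
Local Notation R := (red col).
Let a (m : 'I_n) := #|component R (w m)|.-1.

Let aE (m : 'I_n) : #|component R (w m)| = (a m).+1.
Proof.
rewrite prednK //; apply/card_gt0P; exists (w m); rewrite inE; exact: conn_refl.
Qed.

Definition child (t : 'I_n) (c : 'I_k) (m : 'I_n) := exists u e,
  [/\ t < m, conn R (w t) u & arc_via ends col (w 0) c e u (w m)].

(** Here [a] counts edges, whereas [excess_children] counts vertices; hence the predecessor and the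
    strict inequalities. *)
Lemma swap_children (t : 'I_n) (c : 'I_k) (J : {set 'I_n}) :
    0 < t -> 0 < #|J| -> {in J, forall m, child t c m} ->
    {in J, forall m, a m < #|J|.-1 /\ a m < D} \/ {in J, forall m, a t + a m < D} ->
  False.
Proof.
move=> t0 J0 chJ small.
have [x xP] := @choice_in _ (V * E) J
  (fun m x => [/\ t < m, conn R (w t) x.1 & arc_via ends col (w 0) c x.2 x.1 (w m)]) J0
  (fun m mJ => let: ex_intro u (ex_intro e h) := chJ m mJ in ex_intro _ (u, e) h).
apply: (@swap_impossible _ _ _ _ _ _ _ _ _ min t c J (fun m => (x m).2) (fun m => (x m).1)) => //.
- by rewrite t0 ltn_ord.
- by move=> m /xP[].
- by move=> m /xP[].
- by move=> m /xP[].
move=> p p0 p_pos le; apply: (excess_children J0 _ p_pos le).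
case: small => small; [left | right] => m mJ; rewrite (aE m); last by rewrite addnS; apply: small.
have [h1 h2] := small m mJ; split=> //.
by move: h1; case: #|J|.
Qed.

Let leg : legal ends col w n. Proof. by case: min => _ []. Qed.
Let n0 : 0 < n. Proof. by case: min => _ []. Qed.
Let r0 : 'I_n := Ordinal n0.

Let root_big : D < a r0. Proof. by case: min => _ []. Qed.

(** With [j.+2] or more such children, their number would exceed the vertex count of each, and all
    could be exchanged at once. *)
Lemma few_children (t : 'I_n) c (M : {set 'I_n}) j : 0 < t -> j <= s ->
  {in M, forall m, child t c m} -> #|[set m in M | a m <= j]| <= j.+1.
Proof.
move=> t0 js chM; rewrite leqNgt; apply/negP=> lt.
apply: (@swap_children t c [set m in M | a m <= j]) => //; first by nlia.
  by move=> m; rewrite inE => /andP[/chM].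
left=> m; rewrite inE => /andP[_ am]; split; first by move: lt am; nlia.
by move: am js s_double dD; rewrite -addnn; nlia.
Qed.

Lemma parent_size (t : 'I_n) c m : 0 < t -> child t c m -> D <= a t + a m.
Proof.
move=> t0 ch; rewrite leqNgt; apply/negP=> lt.
apply: (@swap_children t c [set m]) => //; rewrite ?cards1 //.
  by move=> m' /set1P->.
by right=> m' /set1P->.
Qed.

Lemma child_of_root (t : 'I_n) c m : (t : nat) = 0 -> child t c m -> s < a m.
Proof.
move=> t0 [u [e [tm tu ar]]]; rewrite t0 in tm tu.
have := root_child min (m := m) (c := c) (e := e) (u := u).
rewrite aE ltnS tm ltn_ord; apply => //.
by move: s_double dD; rewrite -addnn; nlia.
Qed.

Lemma parent_exists (m : 'I_n) : exists x : 'I_n * 'I_k, 0 < m -> child x.1 x.2 m.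
Proof.
have [m0|] := posnP m; first by exists (m, Ordinal k0).
move=> m0; have [|[t [u [tm tu [c [e ar]]]]] _] := leg (j := m); first by rewrite m0 ltn_ord.
by exists (Ordinal (ltn_trans tm (ltn_ord m)), c) => _; exists u, e.
Qed.

(** The deficit relative to [d / (k+1)] edges, with the denominator cleared and truncated at
    zero. *)
Let def m := d - k.+1 * a m.

Lemma def_small m : 0 < def m -> a m <= s.
Proof. by rewrite /def subn_gt0; apply: small_le. Qed.

Lemma def_nonroot m : 0 < def m -> 0 < m.
Proof.
move=> dm; rewrite lt0n; apply/eqP=> m0; have Em : m = r0 by apply/val_inj.
by move: (def_small dm) root_big s_double dD; rewrite Em -addnn; nlia.
Qed.

(** Let [m0] be a smallest of these children. By [parent_size], [t] has at least [D - a m0] edges.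
    The missing [a m0] is regained because no child has a deficit above that of [m0], which improves
    the bound in every colour. *)
Lemma group_deficit (pc : 'I_n -> 'I_n * 'I_k) (t : 'I_n) :
    (forall m : 'I_n, 0 < m -> child (pc m).1 (pc m).2 m) ->
  \sum_(c < k) \sum_(m | (0 < def m) && (pc m == (t, c))) def m <= k.+1 * a t - d.
Proof.
move=> pcP; pose M c := [set m | (0 < def m) && (pc m == (t, c))].
have chM c : {in M c, forall m, child t c m}.
  by move=> m; rewrite inE => /andP[/def_nonroot/pcP]; case: (pc m) => t' c' /= h /eqP[<- <-].
have MS c : {in M c, forall m, a m <= s} by move=> m; rewrite inE => /andP[/def_small].
pose P m := [exists c, m \in M c].
have [/existsP[m1 Pm1]|none] := boolP [exists m, P m]; last first.
  rewrite big1 // => c _; rewrite big1 // => m h; exfalso; move/negP: none; apply.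
  by apply/existsP; exists m; apply/existsP; exists c; rewrite inE.
have [m0 /existsP[c0 m0M] minm] := arg_minnP a Pm1.
have m0s := MS _ _ m0M.
have t0 : 0 < t.
  rewrite lt0n; apply/eqP=> t0; have := child_of_root t0 (chM _ _ m0M).
  by rewrite ltnNge m0s.
have big := parent_size t0 (chM _ _ m0M).
(* The deficit of a component with [j] edges, capped by that of [m0]. *)
pose f j := d - k.+1 * maxn j (a m0).
have fmono : {homo f : i j / i <= j >-> j <= i}.
  by move=> i j ij; rewrite leq_sub2l // leq_mul2l /=; move: ij; nlia.
have tree c : \sum_(m | (0 < def m) && (pc m == (t, c))) def m <= \sum_(j < s.+1) f j.
  have -> : \sum_(m | (0 < def m) && (pc m == (t, c))) def m = \sum_(m in M c) f (a m).
    apply: eq_big => m; first by rewrite inE.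
    move=> h; rewrite /f (maxn_idPl _) //; apply: minm; apply/existsP; exists c.
    by rewrite inE.
  apply: leq_trans (sum_sparse (M := M c) (h := a) fmono (MS c) _); first exact: leq_addr.
  by move=> j js; apply: (few_children t0 js (chM c)).
apply: (@leq_trans (\sum_(c < k) \sum_(j < s.+1) f j)).
  by apply: leq_sum => c _; apply: tree.
rewrite sum_nat_const card_ord.
(* The gain from the cap in the term for [j = 0] alone suffices. *)
have fsum : \sum_(j < s.+1) f j + k.+1 * a m0 <= \sum_(j < s.+1) (d - k.+1 * j).
  rewrite big_ord_recl [X in _ <= X]big_ord_recl /= addnAC leq_add //.
    rewrite /f max0n muln0 subn0 subnK //; apply: ltnW; apply: leq_ltn_trans s_lt.
    by rewrite leq_mul2l m0s orbT.
  by apply: leq_sum => j _; rewrite /f leq_sub2l // leq_mul2l leq_maxl orbT.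
have h1 : k * (\sum_(j < s.+1) f j) + k * (k.+1 * a m0) <= k * (\sum_(j < s.+1) (d - k.+1 * j)).
  by rewrite -mulnDr leq_mul2l fsum orbT.
have h2 : k.+1 * D <= k.+1 * a t + k.+1 * a m0 by rewrite -mulnDr leq_mul2l big orbT.
have h3 : k.+1 * a m0 <= k * (k.+1 * a m0) by rewrite leq_pmull.
move: bound h1 h2 h3; move: (k * (k.+1 * a m0)) (k.+1 * a m0) (k.+1 * a t) (k.+1 * D).
by move: (k * \sum_(j < s.+1) f j) (k * \sum_(j < s.+1) _); clear; lia.
Qed.

Lemma deficit_le_surplus : \sum_m def m <= \sum_(t < n) (k.+1 * a t - d).
Proof.
have [pc pcP] := fin_all_exists parent_exists.
have -> : \sum_m def m = \sum_(m | 0 < def m) def m.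
  rewrite (bigID (fun m => 0 < def m)) /= [X in _ + X]big1 ?addn0 // => m.
  by rewrite -eqn0Ngt => /eqP.
rewrite (partition_big pc xpredT) //= -(pair_bigA _ (fun t c =>
  \sum_(m | (0 < def m) && (pc m == (t, c))) def m)) /=.
by apply: leq_sum => t _; apply: group_deficit.
Qed.

(** Let [x] be the number of red edges inside the explored set. Density and the edge counts give
    [k.+1 * x <= d * n.-1], while discharging gives [k.+1 * x >= d * n]. *)
Lemma minimal_not_sparse :
  ~ (forall S : {set V}, 1 < #|S| ->
     #|inside ends S| * (d + k + 1) <= (k * (d + k + 1) + d) * #|S|.-1).
Proof.
move=> dens; have [[aB aR] _ _ _ _] := min.
have unf := minimal_unfillable min; have cl := minimal_closed min.
set S := explored ends col w n.
have cS : \sum_(m < n) (a m).+1 <= #|S|.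
  have := card_explored leg; under eq_bigr => m _ do rewrite aE; exact.
have S1 : 1 < #|S|.
  apply: leq_trans cS; rewrite (bigD1 r0) //= addSn ltnS.
  by apply: leq_trans (leq_addr _ _); apply: leq_ltn_trans root_big.
have := dens S S1; have := card_red_explored leg aR; have := card_inside_explored aB unf leg n0 cl.
rewrite -/S.
have balance : \sum_(m < n) (k.+1 * a m) + \sum_m def m =
    n * d + \sum_(m < n) (k.+1 * a m - d).
  have -> : n * d = \sum_(m < n) d by rewrite sum_nat_const card_ord.
  by rewrite -!big_split /=; apply: eq_bigr => m _; rewrite /def; nlia.
have := deficit_le_surplus.
have cS' : \sum_(m < n) a m + n <= #|S|.
  apply: leq_trans cS; under [X in _ <= X]eq_bigr do rewrite -addn1.
  by rewrite big_split /= sum1_card card_ord.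
move: balance; rewrite -big_distrr /=.
move: (\sum_m def m) (\sum_(m < n) (_ - d)) (\sum_(m < n) a m) cS' S1 d0.
move: #|S| #|_ :&: _| #|inside _ S|; clear; nia.
Qed.

End Contradiction.
End Main.

Theorem bounded_forest_partition (V E : finType) (ends : E -> V * V) (k d D : nat) :
    (forall e, (ends e).1 != (ends e).2) -> 0 < d -> 0 < k -> d <= D ->
    k * (\sum_(j < (d.-1 %/ k.+1).+1) (d - k.+1 * j)) + d <= k.+1 * D ->
    (forall S : {set V}, 1 < #|S| ->
      #|inside ends S| * (d + k + 1) <= (k * (d + k + 1) + d) * #|S|.-1) ->
  exists col : E -> option 'I_k, valid ends col /\
    forall v, #|component ends (red col) v|.-1 <= D.
Proof.
move=> noloop d0 k0 dD bound dens; set s := d.-1 %/ k.+1.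
have [|col1 [val1 min1]] := @exists_min _ (@valid V E ends k) (fun col => #|red col|).
  apply: valid_partition => // S S1.
  rewrite -(leq_pmul2r (m := d + k + 1)); last by rewrite addn1.
  apply: leq_trans (dens S S1) _; rewrite mulnAC leq_mul2r mulSn; apply/orP; right.
  by rewrite addnC leq_add2r -addnA leq_addr.
have [|col2 [[val2 red2] min2]] := @exists_min _
    (fun col : E -> option 'I_k => valid ends col /\ #|red col| <= #|red col1|)
    (fun col => total_excess ends D (red col)).
  by exists col1.
apply: NNPP => none.
have [v big] : exists v, D < #|component ends (red col2) v|.-1.
  apply/existsP; apply: contraT; rewrite negb_exists => /forallP le.
  by case: none; exists col2; split=> // v; rewrite leqNgt.
(* This makes an oversized component large enough for a vertex that is central at [s.+1]. *)
have sd : s.*2 < d.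
  have : k.+1 * s < d by have := leq_trunc_div d.-1 k.+1; rewrite -/s mulnC; nlia.
  by apply: leq_ltn_trans; rewrite -mul2n leq_mul2r ltnS k0 orbT.
have [|r vr cen] := @central_exists _ _ ends (red col2) s.+1 v (proj2 val2).
  by rewrite doubleS; move: big sd dD; nlia.
have compr : component ends (red col2) r = component ends (red col2) v.
  apply/setP=> x; rewrite !inE; apply/idP/idP=> h; first exact: conn_trans vr h.
  by apply: conn_trans h; rewrite conn_sym.
have [|[[col w] n] [[/= nw cfg] min3]] := @exists_min _
    (fun x : (E -> option 'I_k) * (nat -> V) * nat =>
      no_worse ends D x.1.1 col2 /\ config ends D s.+1 x.1.1 x.1.2 x.2)
    (fun x => code ends x.1.1 x.1.2 x.2).
  exists (col2, fun=> r, 1); split=> //=; split=> //; last by rewrite compr.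
  by move=> j; rewrite ltnS leqn0 andbC; case: eqP => // ->.
case: (nw) => val3 red3 exc3.
apply: (@minimal_not_sparse _ _ ends k d D d0 k0 dD bound col w n) dens.
split; [exact: val3 | exact: cfg | | |].
- by move=> col' /min1; apply: leq_trans; apply: leq_trans red3 red2.
- move=> col' val' le'; apply: leq_trans exc3 _; apply: min2; split=> //.
  by apply: leq_trans le' _; apply: leq_trans red3 red2.
- move=> col' w' n' [val' le' exc'] cfg'; apply: (min3 (col', w', n')).
  split; last exact: cfg'.
  by split; [exact: val' | apply: leq_trans le' red3 | apply: leq_trans exc' exc3].
Qed.

(** * Arithmetic of the bound and the passage to the stated form *)

Lemma sum_deficits k d : 0 < d -> let s := d.-1 %/ k.+1 in
  2 * (\sum_(j < s.+1) (d - k.+1 * j)) + k.+1 * (s * s.+1) = 2 * (s.+1 * d).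
Proof.
move=> d0 s.
have sd : k.+1 * s < d by have := leq_trunc_div d.-1 k.+1; rewrite -/s mulnC; nlia.
suff main m : m <= s ->
    2 * (\sum_(j < m.+1) (d - k.+1 * j)) + k.+1 * (m * m.+1) = 2 * (m.+1 * d) by apply: main.
elim: m => [_|m IHm ms]; first by rewrite big_ord1 /= mul0n !muln0 subn0 addn0 mul1n.
rewrite big_ord_recr /=; have IH := IHm (ltnW ms).
have : k.+1 * m.+1 <= d by apply: ltnW; apply: leq_ltn_trans sd; rewrite leq_mul2l ms orbT.
by move: IH; move: (\sum_(j < m.+1) _) => x; clear; nia.
Qed.

Local Open Scope ring_scope.

(** The inner ceiling is [s.+1], as [d] lies above [k.+1 * s] and is at most [k.+1 * s.+1]. The
    argument [x] of the outer ceiling is nonnegative, so the ceiling is a natural number [c]; the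
    inequality is [x <= c] multiplied by [2 * k.+1]. *)
Lemma ceil_deficit (k d : nat) : (0 < d)%N -> (0 < k)%N ->
  let s := (d.-1 %/ k.+1)%N in
  exists2 c : nat, c%:Z = Num.ceil (k%:R * ((Num.ceil (d%:R / (k.+1)%:R : rat))%:~R - 1)
                           * (d%:R / (k.+1)%:R
                              - (Num.ceil (d%:R / (k.+1)%:R : rat))%:~R / 2) : rat)
    & (k * (2 * (s * d)) <= k.+1 * (2 * c) + k * (k.+1 * (s * s.+1)))%N.
Proof.
move=> d0 k0 s.
have sd : (k.+1 * s < d)%N by have := leq_trunc_div d.-1 k.+1; rewrite -/s mulnC; nlia.
have ds : (d <= k.+1 * s.+1)%N.
  by have := ltn_ceil d.-1 (ltn0Sn k); rewrite -/s mulnC; nlia.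
have k1 : (0 : rat) < k.+1%:R by rewrite ltr0n.
have -> : Num.ceil (d%:R / k.+1%:R : rat) = s.+1%:Z.
  apply: ceil_def; rewrite -[s.+1]addn1 PoszD addrK ltr_pdivlMr // ler_pdivrMr //.
  by rewrite -!pmulrn -!natrM ltr_nat ler_nat mulnC sd mulnC addn1.
have -> : (s.+1%:Z)%:~R - 1 = s%:R :> rat by rewrite -pmulrn -addn1 natrD addrK.
set x : rat := _ * _.
have Ex : k.+1%:R * (2 * x) = k%:R * (2 * (s%:R * d%:R)) - k%:R * (k.+1%:R * (s%:R * s.+1%:R)).
  by rewrite /x -pmulrn; field; rewrite nat1r lt0r_neq0.
have x0 : 0 <= x.
  rewrite -(pmulr_rge0 _ k1) -(pmulr_rge0 _ (ltr0n rat 2)) mulrCA Ex subr_ge0.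
  rewrite -!natrM ler_nat leq_mul2l; apply/orP; right.
  by have := leq_mul (leqnn s) sd; case: (s) sd => [|s'] *; nia.
exists `|Num.ceil x|%N.
  by rewrite gez0_abs // ceil_ge0 (lt_le_trans _ x0).
have := ceil_ge x; rewrite -[in X in _ <= X -> _](@gez0_abs (Num.ceil x)); last first.
  by rewrite ceil_ge0 (lt_le_trans _ x0).
rewrite -pmulrn => le.
rewrite -(ler_nat rat) natrD !natrM -lerBlDr -Ex ler_pM2l // ler_pM2l //.
Qed.

Lemma frac_arb_density (V E : finType) (ends : E -> V * V) (k d : nat) :
    frac_arb ends <= k%:R + d%:R / (d + k + 1)%:R ->
  forall S : {set V}, (1 < #|S|)%N ->
    (#|inside ends S| * (d + k + 1) <= (k * (d + k + 1) + d) * #|S|.-1)%N.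
Proof.
move=> le S S1.
have q0 : (0 : rat) < (d + k + 1)%:R by rewrite ltr0n addn1.
have m0 : (0 : rat) < #|S|.-1%:R by rewrite ltr0n -subn1 subn_gt0.
have {}le : (#|inside ends S|)%:R / (#|S|.-1)%:R <= k%:R + d%:R / (d + k + 1)%:R :> rat.
  apply: le_trans le; rewrite /frac_arb.
  apply: le_trans (le_bigmax_cond _ _ S1).
  apply: (le_bigmax_cond _ (fun F : {set E} => (#|F|)%:R / (#|S|.-1)%:R : rat)).
  by apply/forall_inP=> e; rewrite inE.
move: le; rewrite ler_pdivrMr // -(ler_pM2r q0) mulrAC mulrDl divfK ?lt0r_neq0 //.
by rewrite -!natrM -natrD -natrM ler_nat.
Qed.

Theorem theorem1p6 (V E : finType) (ends : E -> V * V)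
  (noloop : forall e, (ends e).1 != (ends e).2)
  (d k : nat) (hd : (0 < d)%N) (hk : (0 < k)%N) :
  frac_arb ends <= k%:R + d%:R / (d + k + 1)%:R ->
  exists col : E -> 'I_k.+1,
    (forall i, is_forest ends [set e | col e == i]) /\
    exists i0 : 'I_k.+1,
      forall v : V,
        (#|comp_edges ends [set e | col e == i0] v|)%:Z <=
        d%:Z + Num.ceil (k%:R * ((Num.ceil (d%:R / (k.+1)%:R : rat))%:~R - 1)
                           * (d%:R / (k.+1)%:R
                              - (Num.ceil (d%:R / (k.+1)%:R : rat))%:~R / 2) : rat).
Proof.
move=> /frac_arb_density dens; have [c <- bound] := ceil_deficit hd hk.
have [||col [[aB aR] small]] :=
  @bounded_forest_partition V E ends k d (d + c) noloop hd hk _ _ dens.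
- exact: leq_addr.
- by have := sum_deficits k hd; move: bound; set s := (_ %/ _)%N; set x := bigop _ _ _; clear; nia.
(* Red becomes the last of the [k.+1] colours. *)
pose colour e := if col e is Some i then lift ord_max i else ord_max.
have clsE o i : i = (if o is Some j then lift ord_max j else ord_max) ->
    [set e | colour e == i] = cls col o.
  move=> ->; apply/setP=> e; rewrite !inE /colour.
  case: (col e) o => [j|] [j'|] //; last by rewrite !eqxx.
  - by rewrite (inj_eq lift_inj).
  - by rewrite eq_sym; apply/negbTE/neq_lift.
  - exact/negbTE/neq_lift.
exists colour; split.
  move=> i; case: (unliftP ord_max i) => [j|] Ei.
    by rewrite (clsE (Some j)) //; apply/acyc_forest/aB.
  by rewrite (clsE None) //; apply: acyc_forest.
exists ord_max => v; rewrite (clsE None) // -PoszD lez_nat.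
exact: leq_trans (card_comp_edges v aR) (small v).
Qed.
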